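(* Let $(x_i,r_i)_{i\in\mathcal{I}}$ be a homogeneous ubiquitous system in a nonempty open set $U\subseteq\mathbb{R}^d$. Then for every real $t>1$, the set $F_t=\{x\in\mathbb{R}^d: |x-x_i|<r_i^t \text{ for infinitely many } i\}$ belongs to the large intersection class $G^{d/t}(U)$.
   Context: Fix a norm $|\cdot|$ on $\mathbb{R}^d$; $\mathcal{L}^d$ is Lebesgue measure. Let $\mathcal{I}$ be a countably infinite index set. A family $(x_i,r_i)_{i\in\mathcal{I}}$ in $\mathbb{R}^d\times(0,\infty)$ is an approximation system if $\sup_i r_i<\infty$ and for every $m\in\mathbb{N}$ the set $\{i: |x_i|<m,\ r_i>1/m\}$ is finite; it is a homogeneous ubiquitous system in a nonempty open set $U$ if moreover for $\mathcal{L}^d$-a.e. $x\in U$ there are infinitely many $i$ with $|x-x_i|<r_i$. Dyadic cubes are the sets $2^{-j}(k+[0,1)^d)$, $j\in\mathbb{Z}$, $k\in\mathbb{Z}^d$. For $t\in(0,d]$ and $E\subseteq\mathbb{R}^d$, $\mathcal{M}^t_\infty(E)=\inf\sum_n(\mathrm{diam}\,\lambda_n)^t$, the infimum over all countable coverings of $E$ by dyadic cubes $\lambda_n$ (of arbitrary size). For $s\in(0,d]$ and a nonempty open $U$, the class $G^s(U)$ consists of all $G_\delta$ subsets $F$ of $\mathbb{R}^d$ such that $\mathcal{M}^t_\infty(F\cap V)=\mathcal{M}^t_\infty(V)$ for every $t\in(0,s)$ and every open $V\subseteq U$. *)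

(* Defs.v *)
From Stdlib Require Import Reals Lra ClassicalEpsilon List ZArith.
From Stdlib Require Vectors.Fin.
Open Scope R_scope.

Definition Rd (d : nat) : Type := Fin.t d -> R.

Definition vsub {d} (x y : Rd d) : Rd d := fun i => x i - y i.

Record is_norm (d : nat) (N : Rd d -> R) : Prop := {
  norm_nonneg : forall x, 0 <= N x;
  norm_definite : forall x, N x = 0 -> forall i, x i = 0;
  norm_homog : forall (c : R) (x : Rd d), N (fun i => c * x i) = Rabs c * N x;
  norm_triangle : forall x y, N (fun i => x i + y i) <= N x + N y
}.

Definition is_open {d} (N : Rd d -> R) (U : Rd d -> Prop) : Prop :=
  forall x, U x -> exists e, 0 < e /\ forall y, N (vsub y x) < e -> U y.

Definition countably_infinite (I : Type) : Prop :=
  exists f : nat -> I, (forall n m, f n = f m -> n = m) /\ (forall i, exists n, f n = i).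

Definition finitely_many {I : Type} (P : I -> Prop) : Prop :=
  exists l : list I, forall i, P i -> In i l.

Definition infinitely_many {I : Type} (P : I -> Prop) : Prop := ~ finitely_many P.

Definition approximation_system {d} {I : Type} (N : Rd d -> R)
    (x : I -> Rd d) (r : I -> R) : Prop :=
  (forall i, 0 < r i) /\
  (exists M, forall i, r i <= M) /\
  (forall m : nat, (1 <= m)%nat ->
     finitely_many (fun i => N (x i) < INR m /\ 1 / INR m < r i)).

Record dcube (d : nat) : Type := mk_dcube { dc_j : Z; dc_k : Fin.t d -> Z }.
Arguments dc_j {d}. Arguments dc_k {d}.

Definition in_dcube {d} (c : dcube d) (x : Rd d) : Prop :=
  forall i, powerRZ 2 (- dc_j c) * IZR (dc_k c i) <= x i
            < powerRZ 2 (- dc_j c) * (IZR (dc_k c i) + 1).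

(* A countable (possibly finite: None entries) covering by dyadic cubes. *)
Definition covers {d} (E : Rd d -> Prop) (cov : nat -> option (dcube d)) : Prop :=
  forall x, E x -> exists n c, cov n = Some c /\ in_dcube c x.

Definition lebesgue_null {d} (E : Rd d -> Prop) : Prop :=
  forall eps, 0 < eps -> exists cov : nat -> option (dcube d), covers E cov /\
    exists S, infinite_sum (fun n => match cov n with
                                     | None => 0
                                     | Some c => (powerRZ 2 (- dc_j c)) ^ d end) S
              /\ S < eps.

Definition homogeneous_ubiquitous {d} {I : Type} (N : Rd d -> R)
    (x : I -> Rd d) (r : I -> R) (U : Rd d -> Prop) : Prop :=
  approximation_system N x r /\
  lebesgue_null (fun y => U y /\ ~ infinitely_many (fun i => N (vsub y (x i)) < r i)).

(* Diameter (supremum of distances); 0 by convention if no lub exists. *)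
Definition diam {d} (N : Rd d -> R) (A : Rd d -> Prop) : R :=
  epsilon (inhabits 0)
    (fun delta => is_lub (fun v => exists y z, A y /\ A z /\ v = N (vsub y z)) delta).

Definition Minf_val {d} (N : Rd d -> R) (t : R) (E : Rd d -> Prop) (S : R) : Prop :=
  exists cov, covers E cov /\
    infinite_sum (fun n => match cov n with
                           | None => 0
                           | Some c => Rpower (diam N (in_dcube c)) t end) S.

(* Two subsets of R have the same infimum in [0,+oo] (empty set = +oo). *)
Definition same_inf (P Q : R -> Prop) : Prop :=
  (forall a, P a -> forall e, 0 < e -> exists b, Q b /\ b < a + e) /\
  (forall b, Q b -> forall e, 0 < e -> exists a, P a /\ a < b + e).

Definition Minf_eq {d} (N : Rd d -> R) (t : R) (E1 E2 : Rd d -> Prop) : Prop :=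
  same_inf (Minf_val N t E1) (Minf_val N t E2).

Definition G_delta {d} (N : Rd d -> R) (F : Rd d -> Prop) : Prop :=
  exists O : nat -> (Rd d -> Prop), (forall n, is_open N (O n)) /\
    forall x, F x <-> forall n, O n x.

Definition in_G {d} (N : Rd d -> R) (s : R) (U : Rd d -> Prop) (F : Rd d -> Prop) : Prop :=
  G_delta N F /\
  forall t, 0 < t < s -> forall V, is_open N V -> (forall y, V y -> U y) ->
    Minf_eq N t (fun y => F y /\ V y) V.

(* Main.v *)
(** Let [lam] be a dyadic cover of [F_t] inside [V] with weight [sum side^t = a].
    Call a cube heavy when the members of [lam] inside it weigh at least as much as
    the cube; the maximal heavy cubes [K] are disjoint, contain every member of [lam]
    and weigh at most [a].  They cover [V], which is all that is needed.

    Otherwise some cube of [V] lies in no maximal heavy cube, and one builds a nested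
    sequence of such cubes, the next one inside a ball [B(x_i, r_i^tau)], whose limit
    lies in [F_t] but in no member of [lam].  To refine a cube [c0], inflate each
    maximal heavy [c] inside [c0] by a small multiple of [side c] when [c] is large and
    by a multiple of [side c ^ (1/tau)] when it is small.  As [c0] is not heavy and
    [t < d/tau < d], the inflated cubes do not fill [c0], so some [z] off them is in
    infinitely many [B(x_i, r_i)].  A cube at [x_i] of side comparable to [r_i^tau] that
    lay in some [c] would put [z] in the inflation of [c]. *)

Require Import Defs.
From Stdlib Require Import Reals Lra Lia List ZArith.
From Stdlib Require Import ClassicalEpsilon FunctionalExtensionality.
From Stdlib Require Vectors.Fin.
Open Scope R_scope.

(** * Finite sums and products *)

(** The index [n] is excluded, unlike in [sum_f_R0], so the empty sum is available and inductions
    start from zero. *)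
Fixpoint psum (f : nat -> R) (n : nat) : R :=
  match n with O => 0 | S m => psum f m + f m end.

Lemma psum_le (f g : nat -> R) (n : nat) :
  (forall k, (k < n)%nat -> f k <= g k) -> psum f n <= psum g n.
Proof.
  induction n as [|n IH]; simpl; intros H; [lra|].
  assert (f n <= g n) by (apply H; lia).
  assert (psum f n <= psum g n) by (apply IH; intros; apply H; lia). lra.
Qed.

Lemma psum_ext (f g : nat -> R) (n : nat) :
  (forall k, (k < n)%nat -> f k = g k) -> psum f n = psum g n.
Proof.
  intros H; apply Rle_antisym; apply psum_le; intros k Hk; rewrite H; auto; lra.
Qed.

Lemma psum_plus (f g : nat -> R) (n : nat) :
  psum (fun k => f k + g k) n = psum f n + psum g n.
Proof. induction n as [|n IH]; simpl; [ring | rewrite IH; ring]. Qed.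

Lemma psum_scal (c : R) (f : nat -> R) (n : nat) :
  psum (fun k => c * f k) n = c * psum f n.
Proof. induction n as [|n IH]; simpl; [ring | rewrite IH; ring]. Qed.

Lemma psum_zero (n : nat) : psum (fun _ => 0) n = 0.
Proof. induction n as [|n IH]; simpl; lra. Qed.

Lemma psum_nonneg (f : nat -> R) (n : nat) : (forall k, 0 <= f k) -> 0 <= psum f n.
Proof. intros H; rewrite <- (psum_zero n); apply psum_le; auto. Qed.

Lemma psum_mono (f : nat -> R) (n m : nat) :
  (forall k, 0 <= f k) -> (n <= m)%nat -> psum f n <= psum f m.
Proof.
  intros H; induction 1 as [|m _ IH]; simpl; [lra|]. specialize (H m); lra.
Qed.

Lemma psum_term (f : nat -> R) (k n : nat) :
  (forall k, 0 <= f k) -> (k < n)%nat -> f k <= psum f n.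
Proof.
  intros H Hk. apply Rle_trans with (psum f (S k)).
  - simpl. pose proof (psum_nonneg f k H). lra.
  - apply psum_mono; [auto | lia].
Qed.

Lemma psum_exchange (f : nat -> nat -> R) (n m : nat) :
  psum (fun i => psum (fun j => f i j) m) n = psum (fun j => psum (fun i => f i j) n) m.
Proof.
  induction n as [|n IH]; simpl; [now rewrite psum_zero|].
  now rewrite IH, psum_plus.
Qed.

(** Serves sums over disjoint families: a member of [lam] lies in at most one maximal heavy cube, so
    [saturation_sum] counts it once. *)
Lemma psum_at_most_one (f : nat -> R) (b : R) (n : nat) :
  0 <= b -> (forall k, f k <= b) ->
  (forall k l, f k <> 0 -> f l <> 0 -> k = l) -> psum f n <= b.
Proof.
  intros Hb Hf Huniq; induction n as [|n IH]; simpl; [lra|].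
  destruct (Req_dec (f n) 0) as [E|E]; [lra|].
  assert (psum f n = 0) as ->.
  { rewrite <- (psum_zero n); apply psum_ext; intros k Hk.
    destruct (Req_dec (f k) 0) as [E'|E']; auto.
    pose proof (Huniq k n E' E); lia. }
  specialize (Hf n); lra.
Qed.

Lemma psum_sum_f_R0 (f : nat -> R) (n : nat) : psum f (S n) = sum_f_R0 f n.
Proof. induction n as [|n IH]; [simpl; ring|]. simpl in *; rewrite IH; ring. Qed.

Lemma psum_le_infinite_sum (f : nat -> R) (S : R) :
  (forall k, 0 <= f k) -> infinite_sum f S -> forall n, psum f n <= S.
Proof.
  intros Hf HS n. apply Rle_trans with (psum f (Datatypes.S n)).
  - apply psum_mono; auto.
  - rewrite psum_sum_f_R0; apply sum_incr; auto.
Qed.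

Lemma infinite_sum_of_bounded (f : nat -> R) (B : R) :
  (forall k, 0 <= f k) -> (forall n, psum f n <= B) ->
  exists S, infinite_sum f S /\ S <= B.
Proof.
  intros Hf HB.
  assert (Hgrow : Un_growing (sum_f_R0 f))
    by (intro n; simpl; specialize (Hf (S n)); lra).
  destruct (growing_cv (sum_f_R0 f) Hgrow) as [S HS].
  { exists B; intros y [n ->]; rewrite <- psum_sum_f_R0; auto. }
  exists S; split; [exact HS|].
  apply Rnot_lt_le; intros Hlt.
  destruct (HS (S - B)) as [n Hn]; [lra|].
  specialize (Hn n (le_n n)); unfold Rdist in Hn.
  pose proof (HB (Datatypes.S n)) as Hb; rewrite psum_sum_f_R0 in Hb.
  apply Rabs_def2 in Hn; lra.
Qed.

(** Merges the inflated cubes with a cover of the null set, so that one covering argument handles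
    both. *)
Definition interleave {A} (f g : nat -> A) (n : nat) : A :=
  if Nat.even n then f (Nat.div2 n) else g (Nat.div2 n).

Lemma interleave_even {A} (f g : nat -> A) (n : nat) : interleave f g (2 * n) = f n.
Proof. unfold interleave. now rewrite Nat.even_even, Nat.div2_double. Qed.

Lemma interleave_odd {A} (f g : nat -> A) (n : nat) : interleave f g (S (2 * n)) = g n.
Proof.
  unfold interleave.
  replace (S (2 * n)) with (2 * n + 1)%nat at 1 by lia.
  now rewrite Nat.even_odd, Nat.div2_succ_double.
Qed.

Lemma psum_interleave {A} (v : A -> R) (f g : nat -> A) (n : nat) :
  psum (fun k => v (interleave f g k)) (2 * n)
  = psum (fun k => v (f k)) n + psum (fun k => v (g k)) n.
Proof.
  induction n as [|n IH]; [simpl; ring|].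
  replace (2 * S n)%nat with (S (S (2 * n))) by lia.
  cbn [psum]; rewrite IH, interleave_odd, interleave_even; ring.
Qed.

(** * Products and finite choices over the coordinates *)

Fixpoint prodF {d : nat} : (Fin.t d -> R) -> R :=
  match d with
  | O => fun _ => 1
  | S d' => fun f => f Fin.F1 * prodF (fun i => f (Fin.FS i))
  end.

Lemma prodF_nonneg {d} (f : Fin.t d -> R) : (forall i, 0 <= f i) -> 0 <= prodF f.
Proof.
  induction d as [|d IH]; simpl; intros H; [lra|].
  apply Rmult_le_pos; auto.
Qed.

Lemma prodF_le {d} (f g : Fin.t d -> R) :
  (forall i, 0 <= f i <= g i) -> prodF f <= prodF g.
Proof.
  induction d as [|d IH]; simpl; intros H; [lra|].
  apply Rmult_le_compat; try apply H.
  - apply prodF_nonneg; intros; apply H.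
  - apply IH; intros; apply H.
Qed.

Lemma prodF_ext {d} (f g : Fin.t d -> R) : (forall i, f i = g i) -> prodF f = prodF g.
Proof. intros H; f_equal; now apply functional_extensionality. Qed.

Lemma prodF_const (d : nat) (c : R) : @prodF d (fun _ => c) = c ^ d.
Proof. induction d as [|d IH]; simpl; [reflexivity | now rewrite IH]. Qed.

(** Linearity of the product in its factor of index [i]; it makes volume and overlap additive under
    bisection. *)
Lemma prodF_split {d} (f g h : Fin.t d -> R) (i : Fin.t d) :
  f i = g i + h i -> (forall j, j <> i -> g j = f j /\ h j = f j) ->
  prodF f = prodF g + prodF h.
Proof.
  induction i as [d|d i IH]; simpl; intros Hi Hj.
  - rewrite Hi.
    rewrite (prodF_ext (fun i => g (Fin.FS i)) (fun i => f (Fin.FS i))),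
      (prodF_ext (fun i => h (Fin.FS i)) (fun i => f (Fin.FS i))); [ring| |];
      intros j; apply Hj; discriminate.
  - rewrite (IH (fun i => f (Fin.FS i)) (fun i => g (Fin.FS i)) (fun i => h (Fin.FS i)) Hi).
    + destruct (Hj Fin.F1) as [-> ->]; [discriminate | ring].
    + intros j Hne; apply Hj; intros E; apply Hne; now apply Fin.FS_inj.
Qed.

Fixpoint coords (d : nat) : list (Fin.t d) :=
  match d with
  | O => nil
  | S d' => Fin.F1 :: map Fin.FS (coords d')
  end.

Lemma in_coords {d} (i : Fin.t d) : In i (coords d).
Proof.
  induction i as [d|d i IH]; simpl; [now left | right].
  now apply in_map.
Qed.

Lemma coords_uniform_eps {d} (P : Fin.t d -> R -> Prop) :
  (forall i e e', 0 < e' <= e -> P i e -> P i e') ->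
  (forall i, exists e, 0 < e /\ P i e) -> exists e, 0 < e /\ forall i, P i e.
Proof.
  intros Hmono Hex.
  assert (Hl : forall l, exists e, 0 < e /\ forall i, In i l -> P i e).
  { induction l as [|j l [e [He IH]]]; [exists 1; simpl; split; [lra | tauto]|].
    destruct (Hex j) as [e' [He' Hj]].
    exists (Rmin e e').
    assert (0 < Rmin e e') by now apply Rmin_glb_lt.
    split; auto; intros i [<-|Hi].
    - apply (Hmono j e'); auto; split; auto; apply Rmin_r.
    - apply (Hmono i e); auto; split; auto; apply Rmin_l. }
  destruct (Hl (coords d)) as [e [He H]].
  exists e; split; auto; intros; apply H, in_coords.
Qed.

Lemma coords_argmax {d} (f : Fin.t (S d) -> R) : exists i, forall j, f j <= f i.
Proof.
  assert (Hl : forall l, exists i, forall j, In j l -> f j <= f i).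
  { induction l as [|j l [i IH]]; [exists Fin.F1; simpl; tauto|].
    destruct (Rle_dec (f j) (f i)).
    - exists i; intros k [<-|Hk]; auto.
    - exists j; intros k [<-|Hk]; [lra|]. specialize (IH k Hk); lra. }
  destruct (Hl (coords (S d))) as [i Hi]; exists i; intros; apply Hi, in_coords.
Qed.

(** * Bisection of boxes *)

Record box (d : nat) : Type := mk_box { lo : Rd d; hi : Rd d }.
Arguments mk_box {d}. Arguments lo {d}. Arguments hi {d}.

Definition upd {d} (f : Rd d) (i : Fin.t d) (v : R) : Rd d :=
  fun j => if Fin.eq_dec j i then v else f j.

Lemma upd_same {d} (f : Rd d) i v : upd f i v i = v.
Proof. unfold upd; destruct (Fin.eq_dec i i); congruence. Qed.

Lemma upd_other {d} (f : Rd d) i v j : j <> i -> upd f i v j = f j.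
Proof. unfold upd; destruct (Fin.eq_dec j i); congruence. Qed.

Definition midpoint {d} (b : box d) (i : Fin.t d) : R := (lo b i + hi b i) / 2.
Definition lower_half {d} (b : box d) i := mk_box (lo b) (upd (hi b) i (midpoint b i)).
Definition upper_half {d} (b : box d) i := mk_box (upd (lo b) i (midpoint b i)) (hi b).

Lemma nested_intervals (l h : nat -> R) :
  (forall n, l n <= l (S n)) -> (forall n, h (S n) <= h n) -> (forall n, l n <= h n) ->
  exists z, forall n, l n <= z <= h n.
Proof.
  intros Hl Hh Hlh.
  assert (Hlm : forall n m, (n <= m)%nat -> l n <= l m)
    by (induction 1; [lra | eapply Rle_trans; eauto]).
  assert (Hhm : forall n m, (n <= m)%nat -> h m <= h n)
    by (induction 1; [lra | eapply Rle_trans; eauto]).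
  assert (Hall : forall n m, l n <= h m).
  { intros n m. apply Rle_trans with (l (max n m)); [apply Hlm; lia|].
    apply Rle_trans with (h (max n m)); [auto | apply Hhm; lia]. }
  destruct (completeness (fun v => exists n, v = l n)) as [z [Hub Hlub]].
  - exists (h O); intros v [n ->]; auto.
  - exists (l O), O; reflexivity.
  - exists z; intros n; split.
    + apply Hub; eauto.
    + apply Hlub; intros v [m ->]; auto.
Qed.

(** The invariant travels in a sigma type, so each chosen successor is again a legal starting point.
    [Rel] sees the step number, which lets step [n] demand an index beyond [n]. *)
Lemma dependent_choice {A : Type} (Rel : nat -> A -> A -> Prop) (Inv : A -> Prop) (a0 : A) :
  Inv a0 -> (forall n a, Inv a -> exists a', Inv a' /\ Rel n a a') ->
  exists f : nat -> A, f O = a0 /\ (forall n, Inv (f n)) /\ forall n, Rel n (f n) (f (S n)).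
Proof.
  intros H0 Hstep.
  pose (T := {a : A | Inv a}).
  assert (step : forall n (a : T), {a' : T | Rel n (proj1_sig a) (proj1_sig a')}).
  { intros n [a Ha]. apply constructive_indefinite_description.
    destruct (Hstep n a Ha) as [a' [Ha' HR]]. now exists (exist _ a' Ha'). }
  pose (f := fix f n : T := match n with
                            | O => exist _ a0 H0
                            | S m => proj1_sig (step m (f m)) end).
  exists (fun n => proj1_sig (f n)); repeat split.
  - intros n; exact (proj2_sig (f n)).
  - intros n; simpl; exact (proj2_sig (step n (f n))).
Qed.

Lemma pow_half_small (D e : R) : 0 < e -> exists n, D * (/ 2) ^ n < e.
Proof.
  intros He.
  destruct (pow_lt_1_zero (/ 2) ltac:(rewrite Rabs_pos_eq; lra) (e / (Rabs D + 1)))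
    as [n Hn].
  { apply Rdiv_lt_0_compat; auto; pose proof (Rabs_pos D); lra. }
  exists n. specialize (Hn n (le_n n)).
  assert (Hp : 0 < (/ 2) ^ n) by (apply pow_lt; lra).
  rewrite Rabs_pos_eq in Hn by lra.
  pose proof (Rabs_pos D); pose proof (Rle_abs D).
  apply (Rmult_lt_compat_r (Rabs D + 1)) in Hn; [|lra].
  unfold Rdiv in Hn; rewrite Rmult_assoc, Rinv_l in Hn by lra. nra.
Qed.

Section Bisection.
Context {d : nat} (P : box d -> Prop).
Hypothesis P_halve : forall b i, P b -> P (lower_half b i) \/ P (upper_half b i).

(** The listed coordinates are cut one at a time; a further cut only shrinks the box, so widths
    already halved stay halved. *)
Lemma halve_coords (l : list (Fin.t d)) (b : box d) :
  P b -> (forall i, lo b i <= hi b i) ->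
  exists b', P b' /\ (forall i, lo b i <= lo b' i /\ lo b' i <= hi b' i /\ hi b' i <= hi b i) /\
    forall i, In i l -> hi b' i - lo b' i <= (hi b i - lo b i) / 2.
Proof.
  intros HP Hwf; induction l as [|j l [b' (HP' & Hin & Hl)]].
  - exists b; repeat split; auto; try lra; simpl; tauto.
  - assert (Hm : lo b' j <= midpoint b' j <= hi b' j
                 /\ hi b' j - midpoint b' j <= (hi b j - lo b j) / 2
                 /\ midpoint b' j - lo b' j <= (hi b j - lo b j) / 2)
      by (unfold midpoint; specialize (Hin j); lra).
    destruct (P_halve b' j HP') as [H|H]; [exists (lower_half b' j) | exists (upper_half b' j)];
      (split; [exact H|]; split; simpl; intros i;
       [specialize (Hin i) | intros Hi; pose proof (Hin i)];
       (destruct (Fin.eq_dec i j) as [->|Hne];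
        [rewrite upd_same | rewrite upd_other by exact Hne]); try lra;
       destruct Hi as [E|Hi]; [congruence | auto]).
Qed.

(** A substitute for compactness, used for coverings by boxes and for the equivalence of norms:
    halve all coordinates repeatedly and take the common point of the nested boxes. *)
Lemma bisection (b0 : box d) (D : R) :
  P b0 -> (forall i, 0 <= hi b0 i - lo b0 i <= D) ->
  exists z : Rd d, (forall i, lo b0 i <= z i <= hi b0 i) /\
    forall e, 0 < e -> exists b, P b /\
      forall i, lo b i <= z i <= hi b i /\ hi b i - lo b i < e.
Proof.
  intros HP0 HD.
  destruct (dependent_choice
    (fun _ b b' => forall i, (lo b i <= lo b' i /\ hi b' i <= hi b i) /\
                             hi b' i - lo b' i <= (hi b i - lo b i) / 2)
    (fun b => P b /\ forall i, lo b i <= hi b i) b0) as [f (Hf0 & Hinv & Hstep)].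
  - split; auto; intros i; specialize (HD i); lra.
  - intros _ b [HP Hwf]. destruct (halve_coords (coords d) b HP Hwf) as [b' (H1 & H2 & H3)].
    exists b'; split; [split; auto; intros i; apply H2|].
    intros i; split; [split; apply H2 | apply H3, in_coords].
  - assert (Hz : forall i, exists z, forall n, lo (f n) i <= z <= hi (f n) i).
    { intros i; apply nested_intervals; intros n; try apply (Hstep n); apply (Hinv n). }
    exists (fun i => proj1_sig (constructive_indefinite_description _ (Hz i))).
    assert (Hzn : forall n i, lo (f n) i
        <= proj1_sig (constructive_indefinite_description _ (Hz i)) <= hi (f n) i)
      by (intros n i; destruct (constructive_indefinite_description _ (Hz i)); auto).
    split; [intros i; specialize (Hzn O i); rewrite Hf0 in Hzn; exact Hzn|].
    assert (Hsize : forall n i, hi (f n) i - lo (f n) i <= D * (/ 2) ^ n).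
    { induction n as [|n IH]; intros i; [rewrite Hf0; simpl; specialize (HD i); lra|].
      pose proof (proj2 (Hstep n i)); specialize (IH i); simpl; lra. }
    intros e He; destruct (pow_half_small D e He) as [n Hn].
    exists (f n); split; [apply Hinv|]; intros i; split; [apply Hzn|].
    specialize (Hsize n i); lra.
Qed.

End Bisection.

(** * Volumes and overlaps of boxes *)

Definition volume {d} (b : box d) : R := prodF (fun i => hi b i - lo b i).

(** The volume of the intersection; [Rmax 0] keeps coordinates in which the boxes are disjoint from
    contributing negative factors. *)
Definition overlap {d} (b c : box d) : R :=
  prodF (fun i => Rmax 0 (Rmin (hi b i) (hi c i) - Rmax (lo b i) (lo c i))).

Ltac minmax := unfold Rmax, Rmin in *; repeat destruct Rle_dec; try lra.

Lemma overlap_nonneg {d} (b c : box d) : 0 <= overlap b c.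
Proof. apply prodF_nonneg; intros; apply Rmax_l. Qed.

Lemma overlap_le_volume {d} (b c : box d) :
  (forall i, lo c i <= hi c i) -> overlap b c <= volume c.
Proof. intros H; apply prodF_le; intros i; specialize (H i); minmax. Qed.

Lemma overlap_inside {d} (b c : box d) :
  (forall i, lo c i <= lo b i <= hi b i /\ hi b i <= hi c i) -> overlap b c = volume b.
Proof. intros H; apply prodF_ext; intros i; specialize (H i); minmax. Qed.

Lemma overlap_halves {d} (b c : box d) i : lo b i <= hi b i -> lo c i <= hi c i ->
  overlap b c = overlap (lower_half b i) c + overlap (upper_half b i) c.
Proof.
  intros Hb Hc; apply prodF_split with i; simpl.
  - rewrite !upd_same; unfold midpoint; minmax.
  - intros j Hj; now rewrite !upd_other.
Qed.

Lemma volume_halves {d} (b : box d) i :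
  volume b = volume (lower_half b i) + volume (upper_half b i).
Proof.
  apply prodF_split with i; simpl.
  - rewrite !upd_same; unfold midpoint; lra.
  - intros j Hj; now rewrite !upd_other.
Qed.

(* Boxes of total volume below that of [b] cannot fill [b]: bisect, keeping the covered
   volume below the volume of the box; near a point of an open [c n] the small boxes
   are completely covered. *)
Lemma uncovered_point {d} (b : box d) (c : nat -> box d) (D S : R) :
  (forall i, 0 <= hi b i - lo b i <= D) ->
  (forall n i, lo (c n) i <= hi (c n) i) ->
  (forall n, psum (fun k => volume (c k)) n <= S) -> S < volume b ->
  exists z : Rd d, (forall i, lo b i <= z i <= hi b i) /\
    forall n, ~ (forall i, lo (c n) i < z i < hi (c n) i).
Proof.
  intros HD Hc HS Hlt.
  destruct (bisection (fun b => (forall i, lo b i <= hi b i) /\ exists S, S < volume b /\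
      forall n, psum (fun k => overlap b (c k)) n <= S)) with (b0 := b) (D := D)
    as [z [Hz Hsmall]]; auto.
  - intros b' i (Hwf & S' & HS' & Hsum).
    assert (Hwfl : forall j, lo (lower_half b' i) j <= hi (lower_half b' i) j).
    { intros j; simpl; destruct (Fin.eq_dec j i) as [->|Hne];
        [rewrite upd_same | rewrite upd_other by auto]; auto.
      unfold midpoint; specialize (Hwf i); lra. }
    assert (Hwfu : forall j, lo (upper_half b' i) j <= hi (upper_half b' i) j).
    { intros j; simpl; destruct (Fin.eq_dec j i) as [->|Hne];
        [rewrite upd_same | rewrite upd_other by auto]; auto.
      unfold midpoint; specialize (Hwf i); lra. }
    (* Half of the slack: if the covered volume of each half exceeded its volume minus [g], the
       total would exceed [volume b' - 2 * g = S']. *)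
    pose (g := (volume b' - S') / 2).
    destruct (classic (forall n, psum (fun k => overlap (lower_half b' i) (c k)) n
                                 <= volume (lower_half b' i) - g)) as [H|Hl].
    { left; split; auto; eexists; split; [|exact H]; unfold g; lra. }
    destruct (classic (forall n, psum (fun k => overlap (upper_half b' i) (c k)) n
                                 <= volume (upper_half b' i) - g)) as [H|Hu].
    { right; split; auto; eexists; split; [|exact H]; unfold g; lra. }
    exfalso.
    apply not_all_ex_not in Hl as [n1 Hn1]; apply not_all_ex_not in Hu as [n2 Hn2].
    pose proof (psum_mono (fun k => overlap (lower_half b' i) (c k)) n1 (max n1 n2)
      (fun k => overlap_nonneg _ _) ltac:(lia)).
    pose proof (psum_mono (fun k => overlap (upper_half b' i) (c k)) n2 (max n1 n2)
      (fun k => overlap_nonneg _ _) ltac:(lia)).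
    specialize (Hsum (max n1 n2)).
    rewrite (psum_ext _ (fun k => overlap (lower_half b' i) (c k)
                                  + overlap (upper_half b' i) (c k))), psum_plus in Hsum
      by (intros; apply overlap_halves; auto).
    pose proof (volume_halves b' i); unfold g in *; lra.
  - split; [intros i; specialize (HD i); lra|].
    exists S; split; auto; intros n; eapply Rle_trans; [|apply (HS n)].
    apply psum_le; intros; now apply overlap_le_volume.
  - exists z; split; auto; intros n Hin.
    destruct (coords_uniform_eps (fun i e => lo (c n) i <= z i - e /\ z i + e <= hi (c n) i))
      as [e [He Hball]].
    { intros i e e' ? [? ?]; split; lra. }
    { intros i; specialize (Hin i).
      exists (Rmin (z i - lo (c n) i) (hi (c n) i - z i)); minmax. }
    destruct (Hsmall e He) as [b' ((Hwf & S' & HS' & Hsum) & Hb')].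
    specialize (Hsum (Datatypes.S n)).
    pose proof (psum_term (fun k => overlap b' (c k)) n (Datatypes.S n)
      (fun k => overlap_nonneg _ _) ltac:(lia)) as Hn.
    cbv beta in Hn; rewrite overlap_inside in Hn; [lra|].
    intros i; specialize (Hball i); specialize (Hb' i); specialize (Hwf i); lra.
Qed.

(** * Norms *)

Lemma Rabs_le_bounds (x a : R) : Rabs x <= a -> - a <= x <= a.
Proof. unfold Rabs; destruct (Rcase_abs x); lra. Qed.

Section Norm.
Context {d : nat} (N : Rd d -> R) (HN : is_norm d N).

Lemma norm_sub_sym (x y : Rd d) : N (vsub x y) = N (vsub y x).
Proof.
  replace (vsub x y) with (fun i => -1 * vsub y x i).
  - rewrite (norm_homog _ _ HN), Rabs_left by lra; ring.
  - apply functional_extensionality; intros i; unfold vsub; ring.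
Qed.

Lemma norm_sub_triangle (x y z : Rd d) : N (vsub x z) <= N (vsub x y) + N (vsub y z).
Proof.
  replace (vsub x z) with (fun i => vsub x y i + vsub y z i).
  - apply (norm_triangle _ _ HN).
  - apply functional_extensionality; intros i; unfold vsub; ring.
Qed.

(** Induction on the list of coordinates allowed to be nonzero: the triangle inequality splits off
    one coordinate vector, whose norm is added to the constant. A final [+ 1] makes the constant at
    least one. *)
Lemma norm_upper : exists C, 1 <= C /\
  forall (x : Rd d) m, 0 <= m -> (forall i, Rabs (x i) <= m) -> N x <= C * m.
Proof.
  assert (Hl : forall l, exists C, 0 <= C /\ forall (x : Rd d) m,
      (forall i, Rabs (x i) <= m) -> (forall i, ~ In i l -> x i = 0) -> 0 <= m ->
      N x <= C * m).
  { induction l as [|j l [C [HC IH]]].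
    - exists 0; split; [lra|]; intros x m _ Hx _.
      replace x with (fun i => 0 * x i)
        by (apply functional_extensionality; intros i; rewrite Hx by tauto; ring).
      rewrite (norm_homog _ _ HN), Rabs_R0; lra.
    - pose (e := upd (fun _ => 0) j 1).
      exists (C + N e); split; [pose proof (norm_nonneg _ _ HN e); lra|].
      intros x m Hm Hx Hm0.
      replace x with (fun i => upd x j 0 i + x j * e i).
      + eapply Rle_trans; [apply (norm_triangle _ _ HN)|].
        rewrite (norm_homog _ _ HN).
        assert (N (upd x j 0) <= C * m).
        { apply IH; auto; intros i;
            (destruct (Fin.eq_dec i j) as [->|Hne];
             [rewrite upd_same | rewrite upd_other by auto]); auto.
          - rewrite Rabs_R0; auto.
          - intros Hi; apply Hx; intros [E|E]; [congruence | auto]. }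
        pose proof (norm_nonneg _ _ HN e). specialize (Hm j). nra.
      + apply functional_extensionality; intros i; unfold e.
        destruct (Fin.eq_dec i j) as [->|Hne];
          [rewrite !upd_same | rewrite !upd_other by auto]; ring. }
  destruct (Hl (coords d)) as [C [HC H]].
  exists (C + 1); split; [lra|]; intros x m Hm0 Hm.
  assert (N x <= C * m) by (apply H; auto; intros i Hi; destruct Hi; apply in_coords).
  lra.
Qed.

(** Otherwise the box [[-1,1]^d] holds vectors of arbitrarily small norm with a coordinate of
    absolute value one, and bisection makes them accumulate at some [z]. By [norm_upper], [N z = 0],
    so [z = 0], which is too far from such vectors. *)
Lemma norm_lower : exists C, 0 < C /\ forall (x : Rd d) i, Rabs (x i) <= C * N x.
Proof.
  destruct norm_upper as [C1 [HC1 Hup]].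
  destruct (classic (exists C, 0 < C /\ forall (x : Rd d) i, Rabs (x i) <= C * N x))
    as [H|Hno]; auto; exfalso.
  destruct (bisection (fun b => forall e, 0 < e -> exists y : Rd d,
      (forall i, lo b i <= y i <= hi b i) /\ (exists i, Rabs (y i) = 1) /\ N y < e))
    with (b0 := @mk_box d (fun _ => -1) (fun _ => 1)) (D := 2) as [z [_ Hz]].
  - intros b i HP.
    match goal with |- ?A \/ ?B => destruct (classic A) as [HA|HA]; [now left|];
      destruct (classic B) as [HB|HB]; [now right|] end.
    exfalso.
    apply not_all_ex_not in HA as [e1 HA]; apply imply_to_and in HA as [He1 HA].
    apply not_all_ex_not in HB as [e2 HB]; apply imply_to_and in HB as [He2 HB].
    destruct (HP (Rmin e1 e2)) as [y (Hy & Hi & HNy)]; [now apply Rmin_glb_lt|].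
    pose proof (Rmin_l e1 e2); pose proof (Rmin_r e1 e2).
    destruct (Rle_dec (y i) (midpoint b i)) as [Hm|Hm].
    + apply HA; exists y; repeat split; auto; try lra; try apply Hy; simpl.
      destruct (Fin.eq_dec i0 i) as [->|Hne];
        [rewrite upd_same | rewrite upd_other by auto]; auto; apply Hy.
    + apply HB; exists y; repeat split; auto; try lra; try apply Hy; simpl.
      destruct (Fin.eq_dec i0 i) as [->|Hne];
        [rewrite upd_same | rewrite upd_other by auto]; try lra; apply Hy.
  - intros e He.
    destruct (classic (forall (x : Rd d) i, Rabs (x i) <= / e * N x)) as [H|H].
    { exfalso; apply Hno; exists (/ e); split; auto; now apply Rinv_0_lt_compat. }
    apply not_all_ex_not in H as [x H]; apply not_all_ex_not in H as [i Hi].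
    apply Rnot_le_lt in Hi.
    (* Dividing [x] by its largest coordinate in absolute value gives the required vector. *)
    assert (Hmax : exists i0, forall j, Rabs (x j) <= Rabs (x i0)).
    { clear - i; destruct d; [inversion i | apply (coords_argmax (fun j => Rabs (x j)))]. }
    destruct Hmax as [i0 Hmax].
    pose proof (Hmax i); pose proof (norm_nonneg _ _ HN x) as Hx0.
    assert (Hie : 0 < / e) by now apply Rinv_0_lt_compat.
    assert (Hpos : 0 < Rabs (x i0)) by nra.
    assert (Hb : forall j, - (1) <= / Rabs (x i0) * x j <= 1).
    { intros j; apply Rabs_le_bounds; rewrite Rabs_mult, Rabs_inv, Rabs_Rabsolu.
      apply (Rmult_le_reg_l (Rabs (x i0))); auto.
      rewrite <- Rmult_assoc, Rinv_r by lra. specialize (Hmax j); lra. }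
    exists (fun j => / Rabs (x i0) * x j); split; [|split].
    + intros j; simpl; specialize (Hb j); lra.
    + exists i0; rewrite Rabs_mult, Rabs_inv, Rabs_Rabsolu; field; lra.
    + rewrite (norm_homog _ _ HN), Rabs_inv, Rabs_Rabsolu.
      apply (Rmult_lt_reg_l (Rabs (x i0))); auto.
      rewrite <- Rmult_assoc, Rinv_r by lra.
      apply (Rmult_lt_reg_l (/ e)); auto.
      replace (/ e * (Rabs (x i0) * e)) with (Rabs (x i0)) by (field; lra). lra.
  - intros i; simpl; lra.
  - assert (Hclose : forall e, 0 < e -> exists y : Rd d, (exists i, Rabs (y i) = 1) /\
        N y < e /\ forall i, Rabs (vsub z y i) <= e).
    { intros e He; destruct (Hz e He) as [b [HP Hb]].
      destruct (HP e He) as [y (Hy & Hi & HNy)]; exists y; repeat split; auto.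
      intros i; specialize (Hy i); specialize (Hb i); unfold vsub; apply Rabs_le; lra. }
    assert (HNz : N z = 0).
    { apply Rle_antisym; [|apply (norm_nonneg _ _ HN)].
      apply Rnot_lt_le; intros Hpos.
      (* With this tolerance, [N (vsub z y) + N y] is strictly below [N z], against the triangle
         inequality. *)
      destruct (Hclose (N z / (1 + C1))) as [y (_ & HNy & Hzy)];
        [apply Rdiv_lt_0_compat; lra|].
      assert (He : 0 <= N z / (1 + C1)) by (apply Rlt_le, Rdiv_lt_0_compat; lra).
      pose proof (Hup (vsub z y) _ He Hzy) as HNzy.
      pose proof (norm_triangle _ _ HN (vsub z y) y) as Ht.
      replace (fun i => vsub z y i + y i) with z in Ht
        by (apply functional_extensionality; intros i; unfold vsub; ring).
      assert (N z = (1 + C1) * (N z / (1 + C1))) by (field; lra). lra. }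
    destruct (Hclose (1 / 2)) as [y ([i Hi] & _ & Hzy)]; [lra|].
    specialize (Hzy i); unfold vsub in Hzy.
    rewrite (norm_definite _ _ HN z HNz i), Rminus_0_l, Rabs_Ropp in Hzy; lra.
Qed.

End Norm.

(** * Dyadic cubes *)

Definition side {d} (c : dcube d) : R := powerRZ 2 (- dc_j c).
Definition corner {d} (c : dcube d) : Rd d := fun i => side c * IZR (dc_k c i).
Definition subcube {d} (c c' : dcube d) : Prop := forall x, in_dcube c x -> in_dcube c' x.

Lemma side_pos {d} (c : dcube d) : 0 < side c.
Proof. apply powerRZ_lt; lra. Qed.

Lemma in_dcubeE {d} (c : dcube d) (x : Rd d) :
  in_dcube c x <-> forall i, corner c i <= x i < corner c i + side c.
Proof.
  unfold in_dcube, corner; fold (side c).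
  split; intros H i; specialize (H i); lra.
Qed.

Lemma in_corner {d} (c : dcube d) : in_dcube c (corner c).
Proof. apply in_dcubeE; intros i; pose proof (side_pos c); lra. Qed.

Lemma side_level {d} (c c' : dcube d) : (dc_j c <= dc_j c')%Z ->
  exists m : Z, (0 < m)%Z /\ side c = IZR m * side c'.
Proof.
  intros H; exists (2 ^ (dc_j c' - dc_j c))%Z; split; [apply Z.pow_pos_nonneg; lia|].
  replace (2 ^ (dc_j c' - dc_j c))%Z with (2 ^ Z.of_nat (Z.to_nat (dc_j c' - dc_j c)))%Z
    by (f_equal; lia).
  rewrite <- pow_IZR, pow_powerRZ, Z2Nat.id by lia.
  unfold side; rewrite <- powerRZ_add by lra; f_equal; lia.
Qed.

(** Measured in units of [side c'], the edges of [c] have integer endpoints and those of [c'] are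
    unit intervals between consecutive integers, so meeting forces inclusion. *)
Lemma dyadic_nested {d} (c c' : dcube d) (x : Rd d) :
  in_dcube c x -> in_dcube c' x -> (dc_j c <= dc_j c')%Z -> subcube c' c.
Proof.
  rewrite !in_dcubeE; intros Hc Hc' Hle y; rewrite !in_dcubeE; intros Hy i.
  destruct (side_level c c' Hle) as [m [Hm Em]].
  specialize (Hc i); specialize (Hc' i); specialize (Hy i).
  unfold corner in *; rewrite Em in *.
  pose proof (side_pos c') as Hs.
  assert (H1 : (m * dc_k c i < dc_k c' i + 1)%Z).
  { apply lt_IZR; rewrite mult_IZR, plus_IZR.
    apply (Rmult_lt_reg_l (side c')); auto; lra. }
  assert (H2 : (dc_k c' i < m * (dc_k c i + 1))%Z).
  { apply lt_IZR; rewrite mult_IZR, plus_IZR.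
    apply (Rmult_lt_reg_l (side c')); auto; lra. }
  assert (H3 : IZR m * IZR (dc_k c i) <= IZR (dc_k c' i))
    by (rewrite <- mult_IZR; apply IZR_le; lia).
  assert (H4 : IZR (dc_k c' i) + 1 <= IZR m * (IZR (dc_k c i) + 1))
    by (rewrite <- !plus_IZR, <- mult_IZR; apply IZR_le; lia).
  apply (Rmult_le_compat_l (side c')) in H3, H4; lra.
Qed.

Lemma dyadic_same_level {d} (c c' : dcube d) (x : Rd d) :
  in_dcube c x -> in_dcube c' x -> dc_j c = dc_j c' -> c = c'.
Proof.
  destruct c as [j k], c' as [j' k']; simpl; intros H H' <-; f_equal.
  apply functional_extensionality; intros i.
  specialize (H i); specialize (H' i); simpl in *.
  assert (Hs : 0 < powerRZ 2 (- j)) by (apply powerRZ_lt; lra).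
  assert (k i < k' i + 1)%Z
    by (apply lt_IZR; rewrite plus_IZR; apply (Rmult_lt_reg_l _ _ _ Hs); lra).
  assert (k' i < k i + 1)%Z
    by (apply lt_IZR; rewrite plus_IZR; apply (Rmult_lt_reg_l _ _ _ Hs); lra).
  lia.
Qed.

Lemma powerRZ2_le (i j : Z) : (i <= j)%Z -> powerRZ 2 i <= powerRZ 2 j.
Proof.
  intros H; replace j with (i + Z.of_nat (Z.to_nat (j - i)))%Z by lia.
  rewrite powerRZ_add, <- pow_powerRZ by lra.
  assert (0 < powerRZ 2 i) by (apply powerRZ_lt; lra).
  assert (1 <= 2 ^ Z.to_nat (j - i)) by (apply pow_R1_Rle; lra). nra.
Qed.

Lemma powerRZ2_lt_inv (i j : Z) : powerRZ 2 i < powerRZ 2 j -> (i < j)%Z.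
Proof.
  intros H; destruct (Z_lt_le_dec i j) as [|Hle]; auto.
  apply powerRZ2_le in Hle; lra.
Qed.

(** If [c] were wider, its corner moved by [side c'] along [i] would stay in [c] but leave [c']. The
    coordinate [i] excludes dimension zero, where all cubes are the same set. *)
Lemma subcube_side {d} (i : Fin.t d) (c c' : dcube d) : subcube c c' -> side c <= side c'.
Proof.
  intros H; apply Rnot_lt_le; intros Hlt.
  pose proof (side_pos c') as Hs'; pose proof (side_pos c) as Hs.
  pose proof (H _ (in_corner c)) as H1; rewrite in_dcubeE in H1.
  assert (H2 : in_dcube c' (upd (corner c) i (corner c i + side c'))).
  { apply H, in_dcubeE; intros j; destruct (Fin.eq_dec j i) as [->|Hne];
      [rewrite upd_same | rewrite upd_other by auto]; lra. }
  rewrite in_dcubeE in H2; specialize (H1 i); specialize (H2 i).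
  rewrite upd_same in H2; lra.
Qed.

Definition cube_at {d} (j : Z) (x : Rd d) : dcube d :=
  mk_dcube d j (fun i => Int_part (powerRZ 2 j * x i)).

Lemma in_cube_at {d} (j : Z) (x : Rd d) : in_dcube (cube_at j x) x.
Proof.
  intros i; simpl.
  destruct (base_Int_part (powerRZ 2 j * x i)) as [H1 H2].
  assert (Hs : 0 < powerRZ 2 (- j)) by (apply powerRZ_lt; lra).
  assert (E : powerRZ 2 (- j) * powerRZ 2 j = 1)
    by (rewrite <- powerRZ_add by lra; rewrite Z.add_opp_diag_l; reflexivity).
  apply (Rmult_le_compat_l (powerRZ 2 (- j))) in H1; [|lra].
  assert (H3 : powerRZ 2 j * x i < IZR (Int_part (powerRZ 2 j * x i)) + 1) by lra.
  apply (Rmult_lt_compat_l (powerRZ 2 (- j))) in H3; [|lra].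
  rewrite <- Rmult_assoc, E in H1, H3; lra.
Qed.

Lemma side_cube_at {d} (j : Z) (x : Rd d) : side (cube_at j x) = powerRZ 2 (- j).
Proof. reflexivity. Qed.

Lemma dyadic_scale (v : R) : 0 < v -> exists j, v / 2 < powerRZ 2 (- j) <= v.
Proof.
  intros Hv.
  pose proof (archimed (ln v / ln 2)) as [H1 H2].
  assert (Hln : 0 < ln 2) by (rewrite <- ln_1; apply ln_increasing; lra).
  assert (Ev : Rpower 2 (ln v / ln 2) = v).
  { unfold Rpower; replace (ln v / ln 2 * ln 2) with (ln v) by (field; lra).
    now apply exp_ln. }
  set (m := up (ln v / ln 2)) in *.
  (* By the choice of [m], the base-two logarithm of [v] lies in [[m - 1, m)], so the exponent
     wanted is [- j = m - 1]. *)
  exists (1 - m)%Z; rewrite powerRZ_Rpower by lra.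
  replace (IZR (- (1 - m))) with (IZR m - 1)
    by (rewrite opp_IZR, minus_IZR; ring).
  split.
  - assert (v < Rpower 2 (IZR m)) by (rewrite <- Ev; apply Rpower_lt; lra).
    unfold Rminus; rewrite Rpower_plus, Rpower_Ropp, Rpower_1 by lra. lra.
  - apply Rle_trans with (2 := Req_le _ _ Ev); apply Rle_Rpower; lra.
Qed.

(** Every cube is a scaled translate of the unit cube, and [delta] is the diameter of the latter.
    Diameters can then be traded for sides at the cost of a constant factor. *)
Lemma diam_dcube {d} (i0 : Fin.t d) (N : Rd d -> R) (HN : is_norm d N) :
  exists delta, 0 < delta /\ forall c : dcube d, diam N (in_dcube c) = delta * side c.
Proof.
  pose (dists := fun (c : dcube d) v =>
    exists y z, in_dcube c y /\ in_dcube c z /\ v = N (vsub y z)).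
  destruct (norm_upper N HN) as [C [HC Hup]].
  pose (u := mk_dcube d 0 (fun _ => 0%Z)).
  assert (Hu : forall y, in_dcube u y <-> forall i, 0 <= y i < 1).
  { intros y; rewrite in_dcubeE; unfold corner, side; simpl.
    split; intros H i; specialize (H i); lra. }
  destruct (completeness (dists u)) as [delta Hdelta].
  { exists (C * 1); intros v (y & z & Hy & Hz & ->); apply Hup; [lra|].
    intros i; apply Rabs_le; rewrite Hu in Hy, Hz; specialize (Hy i); specialize (Hz i).
    unfold vsub; lra. }
  { exists (N (vsub (corner u) (corner u))), (corner u), (corner u).
    split; [|split]; apply in_corner || reflexivity. }
  exists delta; split.
  - pose (y := upd (fun _ => 0) i0 (1 / 2) : Rd d); pose (z := (fun _ => 0) : Rd d).
    assert (Hy : in_dcube u y).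
    { apply Hu; intros i; unfold y; destruct (Fin.eq_dec i i0) as [->|Hne];
        [rewrite upd_same | rewrite upd_other by auto]; lra. }
    assert (Hz : in_dcube u z) by (apply Hu; intros i; unfold z; lra).
    apply Rlt_le_trans with (N (vsub y z)).
    + destruct (Rle_lt_or_eq_dec _ _ (norm_nonneg _ _ HN (vsub y z))) as [|E]; auto.
      symmetry in E; pose proof (norm_definite _ _ HN _ E i0) as H.
      unfold vsub, y, z in H; rewrite upd_same in H; lra.
    + apply Hdelta; exists y, z; auto.
  - intros c.
    pose proof (side_pos c) as Hs.
    assert (Hlub : is_lub (dists c) (delta * side c)).
    { assert (Hscale : forall y z, N (vsub y z) =
        side c * N (vsub (fun i => / side c * (y i - corner c i))
                         (fun i => / side c * (z i - corner c i)))).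
      { intros y z; rewrite <- (Rabs_pos_eq (side c)) at 1 by lra.
        rewrite <- (norm_homog _ _ HN); f_equal; apply functional_extensionality.
        intros i; unfold vsub; field; lra. }
      assert (Hin : forall y, in_dcube c y ->
                in_dcube u (fun i => / side c * (y i - corner c i))).
      { intros y; rewrite in_dcubeE, Hu; intros Hy i; specialize (Hy i); split.
        - apply Rmult_le_pos; [apply Rlt_le, Rinv_0_lt_compat; auto | lra].
        - apply (Rmult_lt_reg_l (side c)); auto.
          rewrite <- Rmult_assoc, Rinv_r by lra; lra. }
      split.
      - intros v (y & z & Hy & Hz & ->); rewrite Hscale, Rmult_comm.
        apply Rmult_le_compat_r; [lra|]; apply Hdelta.
        eexists _, _; split; [apply Hin, Hy | split; [apply Hin, Hz | reflexivity]].
      - intros b Hb.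
        apply Rle_trans with (b / side c * side c); [|apply Req_le; field; lra].
        apply Rmult_le_compat_r; [lra|]; apply Hdelta.
        intros v (y & z & Hy & Hz & ->).
        apply (Rmult_le_reg_l (side c)); auto.
        replace (side c * (b / side c)) with b by (field; lra); apply Hb.
        exists (fun i => corner c i + side c * y i), (fun i => corner c i + side c * z i).
        rewrite Hu in Hy, Hz; split; [|split].
        + apply in_dcubeE; intros i; specialize (Hy i); nra.
        + apply in_dcubeE; intros i; specialize (Hz i); nra.
        + rewrite <- (Rabs_pos_eq (side c)) at 1 by lra.
          rewrite <- (norm_homog _ _ HN); f_equal; apply functional_extensionality.
          intros i; unfold vsub; ring. }
    (* Since a supremum exists by [Hlub], the [epsilon] in [diam] does select one, and suprema are
       unique. *)
    apply (is_lub_u (dists c)); auto.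
    unfold diam; apply epsilon_spec; eauto.
Qed.

(** * Saturating a cover *)

Definition weight (t : R) {d} (c : dcube d) : R := Rpower (side c) t.

(** Excluded cubes keep their index with value zero, so sums over different classes of cubes compare
    term by term. *)
Definition wterm {d} (t : R) (f : nat -> option (dcube d)) (Q : dcube d -> Prop) (k : nat) : R :=
  match f k with
  | Some c => if excluded_middle_informative (Q c) then weight t c else 0
  | None => 0
  end.

Lemma weight_pos (t : R) {d} (c : dcube d) : 0 < weight t c.
Proof. apply exp_pos. Qed.

Lemma wterm_nonneg {d} t f (Q : dcube d -> Prop) k : 0 <= wterm t f Q k.
Proof.
  unfold wterm; destruct (f k) as [c|]; [|lra].
  pose proof (weight_pos t c); destruct excluded_middle_informative; lra.
Qed.

Lemma wterm_some {d} t f (Q : dcube d -> Prop) k c :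
  f k = Some c -> Q c -> wterm t f Q k = weight t c.
Proof.
  unfold wterm; intros -> HQ; destruct excluded_middle_informative; tauto.
Qed.

Lemma wterm_neq0 {d} t f (Q : dcube d -> Prop) k :
  wterm t f Q k <> 0 -> exists c, f k = Some c /\ Q c.
Proof.
  unfold wterm; destruct (f k) as [c|]; [|lra].
  destruct excluded_middle_informative; [eauto | lra].
Qed.

Lemma wterm_le {d} t f (Q Q' : dcube d -> Prop) k :
  (forall c, f k = Some c -> Q c -> Q' c) -> wterm t f Q k <= wterm t f Q' k.
Proof.
  intros H; destruct (Req_dec (wterm t f Q k) 0) as [->|E]; [apply wterm_nonneg|].
  destruct (wterm_neq0 _ _ _ _ E) as [c [Hc HQ]].
  rewrite (wterm_some _ _ _ _ _ Hc HQ), (wterm_some _ _ _ _ _ Hc (H c Hc HQ)); lra.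
Qed.

Lemma subcube_level {d} (i : Fin.t d) (c c' : dcube d) :
  subcube c c' -> (dc_j c' <= dc_j c)%Z.
Proof.
  intros H; apply (subcube_side i) in H; unfold side in H.
  destruct (Z_le_gt_dec (dc_j c') (dc_j c)) as [|Hgt]; auto.
  assert (Hlt : powerRZ 2 (- dc_j c') < powerRZ 2 (- dc_j c)).
  { rewrite !powerRZ_Rpower by lra; apply Rpower_lt; [lra | apply IZR_lt; lia]. }
  lra.
Qed.

Lemma first_index (P : nat -> Prop) :
  (exists k, P k) -> exists k, P k /\ forall l, (l < k)%nat -> ~ P l.
Proof.
  intros [k Hk]; induction k as [k IH] using (well_founded_induction Wf_nat.lt_wf).
  destruct (classic (exists l, (l < k)%nat /\ P l)) as [(l & Hl & HP)|H].
  - exact (IH l Hl HP).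
  - exists k; split; auto; intros l Hl HP; apply H; eauto.
Qed.

Section Saturation.
Context {d : nat} (i0 : Fin.t d) (t A : R) (lam : nat -> option (dcube d)).
Hypothesis t_pos : 0 < t.
Hypothesis lam_sum : forall n, psum (wterm t lam (fun _ => True)) n <= A.

(* Finite partial sums: a cube that is not heavy then has all partial sums, hence the
   whole sum, at most its own weight. *)
Definition heavy (c : dcube d) : Prop :=
  exists n, weight t c <= psum (wterm t lam (fun c' => subcube c' c)) n.

Definition maximal_heavy (c : dcube d) : Prop :=
  heavy c /\ forall c', heavy c' -> subcube c c' -> c' = c.

Lemma heavy_cover k c : lam k = Some c -> heavy c.
Proof.
  intros Hk; exists (S k).
  rewrite <- (wterm_some t lam (fun c' => subcube c' c) k c Hk) by (intros x; auto).
  apply psum_term; [apply wterm_nonneg | lia].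
Qed.

(** A heavy cube weighs at most the total bound [A], which bounds its side. *)
Lemma heavy_level_bound : exists J, forall c, heavy c -> (J < dc_j c)%Z.
Proof.
  (* [Rabs A + 1] gives [Rpower] a positive base that exceeds [A]; the factor two in the next line
     makes the power of two strictly larger than [B]. *)
  pose (B := Rpower (Rabs A + 1) (/ t)).
  destruct (dyadic_scale (2 * B)) as [J [HJ _]]; [pose proof (exp_pos (/ t * ln (Rabs A + 1)));
    unfold B, Rpower; lra|].
  exists J; intros c [n Hn].
  assert (Hw : weight t c <= A).
  { eapply Rle_trans; [exact Hn|]; eapply Rle_trans; [|apply (lam_sum n)].
    apply psum_le; intros; apply wterm_le; auto. }
  assert (HB : side c <= B).
  { apply Rnot_lt_le; intros Hlt.
    assert (Rpower B t < weight t c).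
    { apply Rlt_Rpower_l; auto; split; auto; apply exp_pos. }
    unfold B in *; rewrite Rpower_mult, Rinv_l, Rpower_1 in *; try lra;
      pose proof (Rle_abs A); pose proof (Rabs_pos A); lra. }
  unfold side in HB; assert (H : powerRZ 2 (- dc_j c) < powerRZ 2 (- J)) by lra.
  apply powerRZ2_lt_inv in H; lia.
Qed.

(** Passing to a different, larger heavy cube strictly lowers the level, since equal levels and a
    common point force equality. Levels stay above [J], so the ascent ends. *)
Lemma heavy_below_maximal c : heavy c -> exists c', maximal_heavy c' /\ subcube c c'.
Proof.
  destruct heavy_level_bound as [J HJ].
  remember (Z.to_nat (dc_j c - J)) as m eqn:Em; revert c Em.
  induction m as [m IH] using (well_founded_induction Wf_nat.lt_wf); intros c Em Hc.
  destruct (classic (exists c', heavy c' /\ subcube c c' /\ c' <> c))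
    as [(c' & Hc' & Hsub & Hne)|Hmax].
  - pose proof (subcube_level i0 _ _ Hsub) as Hle; pose proof (HJ c' Hc').
    assert (dc_j c' <> dc_j c).
    { intros E; apply Hne, (dyadic_same_level _ _ (corner c)); auto; [apply Hsub|];
        apply in_corner. }
    destruct (IH (Z.to_nat (dc_j c' - J)) ltac:(lia) c' eq_refl Hc') as [c'' [H1 H2]].
    exists c''; split; auto; intros x Hx; auto.
  - exists c; split; [|intros x; auto]; split; auto; intros c' Hc' Hsub.
    apply NNPP; intros Hne; apply Hmax; eauto.
Qed.

Lemma maximal_heavy_unique c c' x :
  maximal_heavy c -> maximal_heavy c' -> in_dcube c x -> in_dcube c' x -> c = c'.
Proof.
  intros [Hc Hmax] [Hc' Hmax'] Hx Hx'.
  destruct (Z.le_ge_cases (dc_j c) (dc_j c')) as [H|H].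
  - apply Hmax'; auto; eapply dyadic_nested; eauto.
  - symmetry; apply Hmax; auto; eapply dyadic_nested; eauto.
Qed.

(* Each maximal heavy cube is listed once, at the index of the first member of [lam] in it. *)
Definition first_member (k : nat) (c : dcube d) : Prop :=
  (exists c', lam k = Some c' /\ subcube c' c) /\
  forall l, (l < k)%nat -> ~ exists c', lam l = Some c' /\ subcube c' c.

Definition saturation (k : nat) : option (dcube d) :=
  match excluded_middle_informative (exists c, maximal_heavy c /\ first_member k c) with
  | left H => Some (proj1_sig (constructive_indefinite_description _ H))
  | right _ => None
  end.

Lemma saturation_some k c :
  saturation k = Some c -> maximal_heavy c /\ first_member k c.
Proof.
  unfold saturation; destruct excluded_middle_informative as [H|]; [|discriminate].
  intros E; injection E as <-; exact (proj2_sig (constructive_indefinite_description _ H)).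
Qed.

Lemma saturation_inj k l c : saturation k = Some c -> saturation l = Some c -> k = l.
Proof.
  intros Hk Hl; apply saturation_some in Hk as [_ [Hk Hk']], Hl as [_ [Hl Hl']].
  destruct (Nat.lt_trichotomy k l) as [H|[H|H]]; auto; exfalso;
    [apply (Hl' k) | apply (Hk' l)]; auto.
Qed.

(** A positive weight can only be reached if some member of [lam] lies in [c]. At the first such
    index, disjointness of maximal heavy cubes identifies the cube chosen there with [c]. *)
Lemma saturation_maximal c : maximal_heavy c -> exists k, saturation k = Some c.
Proof.
  intros Hc; pose proof (proj1 Hc) as [n Hn].
  assert (Hex : exists k, exists c', lam k = Some c' /\ subcube c' c).
  { apply NNPP; intros Hno.
    assert (psum (wterm t lam (fun c' => subcube c' c)) n <= psum (fun _ => 0) n).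
    { apply psum_le; intros k _; apply Req_le, NNPP; intros H.
      apply wterm_neq0 in H as [c' H]; apply Hno; eauto. }
    rewrite psum_zero in *; pose proof (weight_pos t c); lra. }
  apply first_index in Hex as [k Hk].
  exists k; destruct (saturation k) as [c''|] eqn:E.
  - apply saturation_some in E as [Hmax [(c1 & H1 & H2) _]].
    destruct Hk as [(c2 & H3 & H4) _]; rewrite H1 in H3; injection H3 as ->.
    f_equal; apply (maximal_heavy_unique _ _ (corner c2)); auto;
      [apply H2 | apply H4]; apply in_corner.
  - unfold saturation in E; destruct excluded_middle_informative as [|H]; [discriminate|].
    exfalso; apply H; exists c; split; auto.
Qed.

(** Each listed cube weighs no more than the members of [lam] inside it. After exchanging the two
    sums, each member counts at most once because the listed cubes are disjoint. *)
Lemma saturation_sum (Q : dcube d -> Prop) (M : nat) :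
  exists n, psum (wterm t saturation Q) M <=
    psum (wterm t lam (fun c => exists m c', saturation m = Some c' /\ Q c' /\ subcube c c')) n.
Proof.
  (* The partial sum witnessing heaviness depends on the cube; finitely many cubes share one that is
     long enough. *)
  assert (Hn : exists n, forall m c, (m < M)%nat -> saturation m = Some c ->
      weight t c <= psum (wterm t lam (fun c' => subcube c' c)) n).
  { induction M as [|M [n IH]]; [exists O; intros; lia|].
    assert (HM : exists n', forall c, saturation M = Some c ->
        weight t c <= psum (wterm t lam (fun c' => subcube c' c)) n').
    { destruct (saturation M) as [c|] eqn:E; [|exists O; discriminate].
      destruct (saturation_some _ _ E) as [[[n' Hn'] _] _].
      exists n'; intros c' E'; injection E' as <-; auto. }
    destruct HM as [n' Hn']; exists (max n n'); intros m c Hm E.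
    destruct (Nat.eq_dec m M) as [->|Hne].
    - eapply Rle_trans; [apply (Hn' c E)|]; apply psum_mono; [apply wterm_nonneg | lia].
    - eapply Rle_trans; [apply (IH m c); auto; lia|].
      apply psum_mono; [apply wterm_nonneg | lia]. }
  destruct Hn as [n Hn]; exists n.
  pose (a := fun m k => match saturation m with
    | Some c => if excluded_middle_informative (Q c)
                then wterm t lam (fun c' => subcube c' c) k else 0
    | None => 0 end).
  apply Rle_trans with (psum (fun m => psum (fun k => a m k) n) M).
  - apply psum_le; intros m Hm; unfold wterm at 1, a.
    destruct (saturation m) as [c|] eqn:E; [|rewrite psum_zero; lra].
    destruct excluded_middle_informative; [exact (Hn m c Hm E) | rewrite psum_zero; lra].
  - rewrite psum_exchange; apply psum_le; intros k _.
    assert (Ha : forall m, a m k <> 0 -> exists c c', saturation m = Some c /\ Q c /\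
        a m k = wterm t lam (fun c' => subcube c' c) k /\ lam k = Some c' /\ subcube c' c).
    { intros m; unfold a; destruct (saturation m) as [c|] eqn:E; [|lra].
      destruct excluded_middle_informative; [|lra]; intros H.
      destruct (wterm_neq0 _ _ _ _ H) as [c' [H1 H2]]; exists c, c'; auto. }
    apply psum_at_most_one; [apply wterm_nonneg| |].
    + intros m; destruct (Req_dec (a m k) 0) as [->|Hne]; [apply wterm_nonneg|].
      destruct (Ha m Hne) as (c & c' & H1 & H2 & -> & _).
      apply wterm_le; eauto.
    + intros m m' H H'.
      destruct (Ha m H) as (c & c' & H1 & _ & _ & H2 & H3).
      destruct (Ha m' H') as (c1 & c1' & H1' & _ & _ & H2' & H3').
      rewrite H2 in H2'; injection H2' as <-.
      apply (saturation_inj m m' c); auto; rewrite H1'; f_equal.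
      apply (maximal_heavy_unique _ _ (corner c')).
      * apply (saturation_some _ _ H1').
      * apply (saturation_some _ _ H1).
      * apply H3', in_corner.
      * apply H3, in_corner.
Qed.

(** For the last clause: if the cubes of [K] inside [c] outweighed [c], so would the members of
    [lam] inside them; then [c] would be heavy and lie in a maximal heavy cube. *)
Lemma saturate : exists K : nat -> option (dcube d),
  (forall k c, lam k = Some c -> exists m c', K m = Some c' /\ subcube c c') /\
  (forall M, psum (wterm t K (fun _ => True)) M <= A) /\
  forall c, (forall m c', K m = Some c' -> ~ subcube c c') ->
    forall M, psum (wterm t K (fun c' => subcube c' c)) M <= weight t c.
Proof.
  exists saturation; repeat split.
  - intros k c Hk; apply heavy_cover, heavy_below_maximal in Hk as [c' [Hc' Hsub]].
    apply saturation_maximal in Hc' as [m Hm]; exists m, c'; auto.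
  - intros M; destruct (saturation_sum (fun _ => True) M) as [n Hn].
    eapply Rle_trans; [exact Hn|]; eapply Rle_trans; [|apply (lam_sum n)].
    apply psum_le; intros; apply wterm_le; auto.
  - intros c Hc M; destruct (saturation_sum (fun c' => subcube c' c) M) as [n Hn].
    eapply Rle_trans; [exact Hn|].
    apply Rnot_lt_le; intros Hlt.
    destruct (heavy_below_maximal c) as [c' [Hmax Hsub]].
    { exists n; apply Rlt_le; eapply Rlt_le_trans; [exact Hlt|].
      apply psum_le; intros k _; apply wterm_le.
      intros c1 _ (m & c2 & _ & H1 & H2) x Hx; auto. }
    apply saturation_maximal in Hmax as [m Hm]; exact (Hc m c' Hm Hsub).
Qed.

End Saturation.

(** * Inflated cubes *)

(** For [S < 1] one has [S <= S^(1/tau)], so the left side is at most [(1 + C)^d * S^(d/tau)], which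
    is negligible against [S^t] because [d/tau > t]. *)
Lemma inflated_volume_small (d : nat) (tau t C B : R) :
  1 < tau -> t < INR d / tau -> 0 <= C -> 0 < B ->
  exists eta, 0 < eta /\ forall S, 0 < S < eta ->
    (S + C * Rpower S (/ tau)) ^ d <= B * Rpower S t.
Proof.
  intros Htau Ht HC HB.
  pose (a := INR d / tau - t). assert (Ha : 0 < a) by (unfold a; lra).
  assert (HD : 0 < (1 + C) ^ d) by (apply pow_lt; lra).
  assert (HBD : 0 < B / (1 + C) ^ d) by now apply Rdiv_lt_0_compat.
  (* Solves [(1 + C)^d * e^a = B], where [a] is the surplus exponent. *)
  pose (e := Rpower (B / (1 + C) ^ d) (/ a)).
  assert (He : 0 < e) by apply exp_pos.
  exists (Rmin 1 e); split; [apply Rmin_glb_lt; lra|]; intros S [HS0 HS].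
  assert (HS1 : S < 1) by (pose proof (Rmin_l 1 e); lra).
  assert (HSe : S < e) by (pose proof (Rmin_r 1 e); lra).
  assert (Htau' : 0 < / tau < 1)
    by (split; [apply Rinv_0_lt_compat; lra | rewrite <- Rinv_1; apply Rinv_lt_contravar; lra]).
  assert (Hpow : 0 < Rpower S (/ tau)) by apply exp_pos.
  assert (H1 : S <= Rpower S (/ tau)).
  { rewrite <- (exp_ln S) at 1 by auto; unfold Rpower.
    assert (Hln : ln S < 0) by (rewrite <- ln_1; apply ln_increasing; lra).
    destruct (Rle_lt_or_eq_dec (ln S) (/ tau * ln S)) as [Hlt|Heq]; [nra| |rewrite <- Heq; lra].
    apply Rlt_le, exp_increasing, Hlt. }
  apply Rle_trans with (((1 + C) * Rpower S (/ tau)) ^ d).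
  { apply pow_incr; split; [|lra]. apply Rplus_le_le_0_compat; [lra|].
    apply Rmult_le_pos; lra. }
  rewrite Rpow_mult_distr, <- (Rpower_pow d (Rpower S (/ tau))), Rpower_mult by auto.
  replace (/ tau * INR d) with (a + t) by (unfold a; field; lra).
  rewrite Rpower_plus.
  assert (H2 : Rpower S a <= B / (1 + C) ^ d).
  { replace (B / (1 + C) ^ d) with (Rpower e a).
    - apply Rle_Rpower_l; lra.
    - unfold e; rewrite Rpower_mult, Rinv_l, Rpower_1; lra. }
  apply (Rmult_le_compat_l ((1 + C) ^ d)) in H2; [|lra].
  replace ((1 + C) ^ d * (B / (1 + C) ^ d)) with B in H2 by (field; lra).
  rewrite <- Rmult_assoc; apply Rmult_le_compat_r; [apply Rlt_le, exp_pos | auto].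
Qed.

Definition inflated {d} (c : dcube d) (e : R) : box d :=
  mk_box (fun i => corner c i - e) (fun i => corner c i + side c + e).

Lemma volume_inflated {d} (c : dcube d) (e : R) :
  volume (inflated c e) = (side c + 2 * e) ^ d.
Proof.
  rewrite <- prodF_const; apply prodF_ext; intros i; simpl; ring.
Qed.

Definition empty_box {d} : box d := mk_box (fun _ => 0) (fun _ => 0).

(** In dimension zero the empty product would give volume one, hence the coordinate [i]. *)
Lemma volume_empty {d} (i : Fin.t d) : volume (@empty_box d) = 0.
Proof.
  destruct d; [inversion i|]. unfold volume; simpl; ring.
Qed.

(** A volume count: the concentric copy of [c0] shrunk by [h] has volume [s^d / p], the inflated
    cubes take at most [s^d / p^2], and a cover of [E] half of the difference. The margin [mu]
    leaves room around [z] inside [c0]; [rho] is a lower bound for the inflation of all cubes of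
    side at least [eta]. *)
Lemma point_off_inflated_cubes {d} (i0 : Fin.t d) (tau t C : R) (c0 : dcube d)
    (K : nat -> option (dcube d)) (E : Rd d -> Prop) :
  1 < tau -> 0 < t < INR d / tau -> 0 <= C -> lebesgue_null E ->
  (forall M, psum (wterm t K (fun c => subcube c c0)) M <= weight t c0) ->
  (forall m c, K m = Some c -> ~ subcube c0 c) ->
  exists (z : Rd d) mu rho, 0 < mu /\ 0 < rho /\
    (forall i, corner c0 i + mu <= z i <= corner c0 i + side c0 - mu) /\ ~ E z /\
    forall m c w, K m = Some c -> subcube c c0 -> in_dcube c w ->
      ~ forall i, Rabs (z i - w i) < Rmin rho (C * Rpower (side c) (/ tau)).
Proof.
  intros Htau Ht HC Hnull Hsum Hgood.
  pose (s := side c0); assert (Hs : 0 < s) by apply side_pos.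
  assert (Hd : 0 < INR d).
  { apply lt_0_INR; destruct d; [inversion i0 | lia]. }
  assert (Htd : t < INR d).
  { apply Rlt_trans with (INR d / tau); [lra|].
    apply (Rmult_lt_reg_r tau); [lra|].
    replace (INR d / tau * tau) with (INR d) by (field; lra). nra. }
  pose (h := Rpower 2 ((INR d - t) / (3 * INR d))).
  assert (Hh : 1 < h).
  { unfold h; rewrite <- (Rpower_O 2) by lra; apply Rpower_lt; [lra|].
    apply Rdiv_lt_0_compat; lra. }
  pose (p := h ^ d).
  assert (Hpexp : p = Rpower 2 ((INR d - t) / 3)).
  { unfold p, h; rewrite <- Rpower_pow by apply exp_pos.
    rewrite Rpower_mult; f_equal; field; lra. }
  assert (Hp3 : p * (p * p) = Rpower 2 (INR d - t))
    by (rewrite Hpexp, <- !Rpower_plus; f_equal; field).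
  assert (Hp : 1 < p).
  { rewrite Hpexp, <- (Rpower_O 2) by lra; apply Rpower_lt; lra. }
  assert (Hsd : 0 < s ^ d) by now apply pow_lt.
  (* Chosen so that a side [u <= s / 2] satisfies [p * u^d <= B * u^t]. *)
  pose (B := p * Rpower (s / 2) (INR d - t)).
  assert (HB : 0 < B) by (apply Rmult_lt_0_compat; [lra | apply exp_pos]).
  assert (HBw : B * weight t c0 = s ^ d / (p * p)).
  { unfold B, weight; fold s. unfold Rdiv at 1.
    rewrite <- Rpower_mult_distr by lra.
    replace (p * (Rpower s (INR d - t) * Rpower (/ 2) (INR d - t)) * Rpower s t)
      with (p * Rpower (/ 2) (INR d - t) * (Rpower s (INR d - t) * Rpower s t)) by ring.
    rewrite <- Rpower_plus; replace (INR d - t + t) with (INR d) by ring.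
    rewrite Rpower_pow by auto.
    replace (Rpower (/ 2) (INR d - t)) with (/ (p * (p * p))); [field; lra|].
    rewrite Hp3. unfold Rpower; rewrite ln_Rinv, Ropp_mult_distr_r_reverse, exp_Ropp by lra.
    reflexivity. }
  (* The constant is [2 * C] because inflation moves both opposite faces. *)
  destruct (inflated_volume_small d tau t (2 * C) B) as [eta [Heta Hsmall]]; try lra.
  (* For [c] strictly inside [c0], [side c <= s / 2] gains the factor [2 ^ (t - d) = h ^ (- 3 d)]
     in volume; inflating costs [h ^ d], shrinking [c0] costs [h ^ d], and the last
     factor [h ^ d] leaves room for the null set. *)
  pose (infl := fun c : dcube d => if Rle_dec eta (side c) then (h - 1) / 2 * side c
                                   else C * Rpower (side c) (/ tau)).
  assert (Hinfl0 : forall c, 0 <= infl c).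
  { intros c; pose proof (side_pos c); unfold infl; destruct Rle_dec.
    - apply Rmult_le_pos; lra.
    - apply Rmult_le_pos; [lra | apply Rlt_le, exp_pos]. }
  assert (Hinfl : forall c, side c <= s / 2 ->
            volume (inflated c (infl c)) <= B * weight t c).
  { intros c Hc; pose proof (side_pos c) as Hsc; rewrite volume_inflated; unfold infl.
    destruct Rle_dec as [Hle|Hle].
    - replace (side c + 2 * ((h - 1) / 2 * side c)) with (h * side c) by field.
      rewrite Rpow_mult_distr; fold p; unfold B.
      rewrite Rmult_assoc; apply Rmult_le_compat_l; [lra|].
      rewrite <- Rpower_pow by auto; unfold weight.
      replace (INR d) with ((INR d - t) + t) at 1 by ring; rewrite Rpower_plus.
      apply Rmult_le_compat_r; [apply Rlt_le, exp_pos|].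
      apply Rle_Rpower_l; lra.
    - rewrite <- Rmult_assoc; apply Hsmall; lra. }
  (* Half of the remaining volume; the division by [2 ^ d] pays for the doubled sides in [boxB]. *)
  pose (beta := s ^ d * (/ p - / (p * p)) / 2 / 2 ^ d).
  assert (H2d : 0 < 2 ^ d) by (apply pow_lt; lra).
  assert (Hpp : / (p * p) < / p) by (apply Rinv_lt_contravar; nra).
  assert (Hbeta : 0 < beta).
  { unfold beta; repeat apply Rdiv_lt_0_compat; try lra. apply Rmult_lt_0_compat; lra. }
  destruct (Hnull beta Hbeta) as [cov (Hcov & Sc & HSc & HScb)].
  pose (boxA := fun m => match K m with
    | Some c => if excluded_middle_informative (subcube c c0)
                then inflated c (infl c) else empty_box
    | None => empty_box end).
  (* Only open boxes are avoided in [uncovered_point], while cubes contain their lower faces;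
     doubling downwards puts each cube in the interior of its box. *)
  pose (boxB := fun m => match cov m with
    | Some c => mk_box (fun i => corner c i - side c) (fun i => corner c i + side c)
    | None => empty_box end).
  assert (HvolA : forall n, psum (fun m => volume (boxA m)) n <= B * weight t c0).
  { intros n; apply Rle_trans with (B * psum (wterm t K (fun c => subcube c c0)) n);
      [|apply Rmult_le_compat_l; [lra | auto]].
    rewrite <- psum_scal; apply psum_le; intros m _; unfold boxA, wterm.
    destruct (K m) as [c|] eqn:EK; [|rewrite (volume_empty i0); lra].
    destruct excluded_middle_informative as [Hsub|]; [|rewrite (volume_empty i0); lra].
    apply Hinfl.
    (* A cube of [K] in [c0] at the level of [c0] or coarser would contain [c0]; so its side is at
       most [s / 2]. *)
    assert (Hlev : (dc_j c0 + 1 <= dc_j c)%Z).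
    { destruct (Z_lt_le_dec (dc_j c0) (dc_j c)) as [|Hle]; [lia|].
      destruct (Hgood m c EK); apply (dyadic_nested c c0 (corner c)); auto;
        [apply in_corner | apply Hsub, in_corner]. }
    assert (H := powerRZ2_le (- dc_j c) (- dc_j c0 - 1) ltac:(lia)).
    unfold Z.sub in H; rewrite powerRZ_add in H by lra; simpl in H.
    unfold s, side; lra. }
  assert (HvolB : forall n, psum (fun m => volume (boxB m)) n <= 2 ^ d * beta).
  { intros n; apply Rle_trans with (2 ^ d * Sc); [|apply Rmult_le_compat_l; lra].
    eapply Rle_trans; [|apply Rmult_le_compat_l;
      [lra | apply psum_le_infinite_sum with (n := n) (2 := HSc)]].
    - rewrite <- psum_scal; apply psum_le; intros m _; unfold boxB.
      destruct (cov m) as [c|]; [|rewrite (volume_empty i0); lra].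
      fold (side c); rewrite <- Rpow_mult_distr, <- prodF_const; apply Req_le, prodF_ext.
      intros i; simpl; ring.
    - intros k; destruct (cov k) as [c|]; [|lra].
      apply pow_le, Rlt_le, (side_pos c). }
  assert (Hwf : forall n i, lo (interleave boxA boxB n) i <= hi (interleave boxA boxB n) i).
  { assert (Hempty : forall i, lo (@empty_box d) i <= hi (@empty_box d) i)
      by (simpl; intros; lra).
    intros n i; unfold interleave; destruct (Nat.even n).
    - unfold boxA; destruct (K _) as [c|]; auto; destruct excluded_middle_informative; auto.
      simpl; pose proof (side_pos c); specialize (Hinfl0 c); lra.
    - unfold boxB; destruct (cov _) as [c|]; auto; simpl; pose proof (side_pos c); lra. }
  assert (Hsh : 0 < s / h < s).
  { split; [apply Rdiv_lt_0_compat; lra|].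
    apply (Rmult_lt_reg_r h); [lra|]. replace (s / h * h) with s by (field; lra). nra. }
  destruct (uncovered_point
    (mk_box (fun i => corner c0 i + (s - s / h) / 2) (fun i => corner c0 i + s - (s - s / h) / 2))
    (interleave boxA boxB) s (B * weight t c0 + 2 ^ d * beta)) as [z [Hz Hnot]].
  - intros i; simpl; lra.
  - exact Hwf.
  - intros n; apply Rle_trans with (psum (fun k => volume (interleave boxA boxB k)) (2 * n)).
    + apply psum_mono; [|lia].
      intros k; apply prodF_nonneg; intros i; specialize (Hwf k i); lra.
    + rewrite psum_interleave; specialize (HvolA n); specialize (HvolB n); lra.
  - rewrite HBw.
    replace (2 ^ d * beta) with (s ^ d * (/ p - / (p * p)) / 2) by (unfold beta; field; lra).
    unfold volume; simpl.
    rewrite (prodF_ext _ (fun _ => s / h)) by (intros; field; lra).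
    rewrite prodF_const.
    replace ((s / h) ^ d) with (s ^ d * / p)
      by (unfold Rdiv, p; rewrite Rpow_mult_distr, pow_inv; reflexivity).
    apply (Rmult_lt_compat_l (s ^ d)) in Hpp; lra.
  - exists z, ((s - s / h) / 2), ((h - 1) / 2 * eta).
    split; [lra|]; split; [apply Rmult_lt_0_compat; lra|]; split; [|split].
    + intros i; specialize (Hz i); simpl in Hz; fold s; lra.
    + intros HE; destruct (Hcov z HE) as (n & c & Hn & Hin).
      apply (Hnot (S (2 * n))); rewrite interleave_odd; unfold boxB; rewrite Hn; simpl.
      rewrite in_dcubeE in Hin; intros i; specialize (Hin i); pose proof (side_pos c); lra.
    + intros m c w HK Hsub Hw Hclose.
      apply (Hnot (2 * m)%nat); rewrite interleave_even; unfold boxA; rewrite HK.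
      destruct excluded_middle_informative; [|tauto]; simpl.
      rewrite in_dcubeE in Hw; intros i; specialize (Hw i); specialize (Hclose i).
      assert (Rmin ((h - 1) / 2 * eta) (C * Rpower (side c) (/ tau)) <= infl c).
      { unfold infl; destruct Rle_dec.
        - eapply Rle_trans; [apply Rmin_l|]; apply Rmult_le_compat_l; lra.
        - apply Rmin_r. }
      apply Rabs_def2 in Hclose; lra.
Qed.

(** * Nested cubes *)

Lemma finitely_many_bounded {I : Type} (f : nat -> I) (P : I -> Prop) :
  (forall n m, f n = f m -> n = m) -> finitely_many P ->
  exists n, forall m, P (f m) -> (m < n)%nat.
Proof.
  intros Hinj [l Hl].
  assert (H : exists n, forall m, In (f m) l -> (m < n)%nat).
  { clear Hl; induction l as [|a l [n IH]]; [exists O; simpl; tauto|].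
    destruct (classic (exists k, f k = a)) as [[k <-]|Hno].
    - exists (max n (S k)); intros m [E|Hm]; [apply Hinj in E | apply IH in Hm]; lia.
    - exists n; intros m [E|Hm]; [exfalso; apply Hno; eauto | auto]. }
  destruct H as [n Hn]; exists n; intros m Hm; apply Hn, Hl, Hm.
Qed.

(** Turns infinitude into countably many conditions, which suits both the G-delta representation and
    the stepwise construction of a limit point. *)
Lemma infinitely_many_enumerated {I : Type} (f : nat -> I) (P : I -> Prop) :
  (forall n m, f n = f m -> n = m) -> (forall i, exists n, f n = i) ->
  infinitely_many P <-> forall n, exists m, (n <= m)%nat /\ P (f m).
Proof.
  intros Hinj Hsurj; split.
  - intros Hinf n; apply NNPP; intros Hno; apply Hinf.
    exists (map f (seq 0 n)); intros i Hi; destruct (Hsurj i) as [m <-].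
    apply in_map, in_seq.
    destruct (Nat.lt_ge_cases m n); [lia | exfalso; apply Hno; eauto].
  - intros H Hfin; destruct (finitely_many_bounded f P Hinj Hfin) as [n Hn].
    destruct (H n) as (m & Hm & HP); apply Hn in HP; lia.
Qed.

Lemma finitely_many_or {I : Type} (P Q R : I -> Prop) :
  finitely_many P -> finitely_many Q -> (forall i, R i -> P i \/ Q i) -> finitely_many R.
Proof.
  intros [l Hl] [l' Hl'] H; exists (l ++ l'); intros i Hi; apply in_or_app.
  destruct (H i Hi); auto.
Qed.

(** Balls containing [z] have centres of norm below [N z + M], so only finitely many have radius at
    least [e]; discarding the first [n] indices removes finitely many more. *)
Lemma small_radius {d} {I : Type} (N : Rd d -> R) (HN : is_norm d N) (x : I -> Rd d)
    (r : I -> R) (f : nat -> I) (z : Rd d) (n : nat) (e : R) :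
  (forall i, exists n, f n = i) ->
  approximation_system N x r -> 0 < e ->
  infinitely_many (fun i => N (vsub z (x i)) < r i) ->
  exists m, (n <= m)%nat /\ N (vsub z (x (f m))) < r (f m) /\ r (f m) < e.
Proof.
  intros Hsurj (_ & [M HM] & Hfin) He Hinf; apply NNPP; intros Hno; apply Hinf.
  destruct (INR_unbounded (Rmax (N z + M) (/ e))) as [k Hk].
  assert (Hk1 : N z + M < INR k) by (eapply Rle_lt_trans; [apply Rmax_l | exact Hk]).
  assert (Hk2 : / e < INR k) by (eapply Rle_lt_trans; [apply Rmax_r | exact Hk]).
  assert (He' : 0 < / e) by now apply Rinv_0_lt_compat.
  assert (Hke : 1 / INR k < e).
  { apply (Rmult_lt_reg_r (INR k)); [lra|].
    replace (1 / INR k * INR k) with 1 by (field; lra).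
    apply (Rmult_lt_compat_l e) in Hk2; auto; rewrite Rinv_r in Hk2; lra. }
  apply finitely_many_or with (fun i => N (x i) < INR k /\ 1 / INR k < r i)
                              (fun i => In i (map f (seq 0 n))).
  - apply Hfin; destruct k; [simpl in *; lra | lia].
  - now exists (map f (seq 0 n)).
  - intros i Hi; destruct (Hsurj i) as [m <-].
    destruct (Nat.lt_ge_cases m n) as [Hmn|Hmn]; [right; apply in_map, in_seq; lia | left].
    split.
    + rewrite norm_sub_sym in Hi by exact HN.
      pose proof (norm_triangle _ _ HN z (vsub (x (f m)) z)) as Ht.
      replace (fun i => z i + vsub (x (f m)) z i) with (x (f m)) in Ht
        by (apply functional_extensionality; intros i; unfold vsub; ring).
      specialize (HM (f m)); lra.
    + apply Rnot_le_lt; intros Hle; apply Hno; exists m; repeat split; auto; lra.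
Qed.

(** One step of the nested construction. The bound [n <= m] makes the balls used infinitely many in
    the end, and inclusion of the closed cube keeps limits inside [c0]. *)
Lemma refine_cube {d} (i0 : Fin.t d) (N : Rd d -> R) (HN : is_norm d N) {I : Type}
    (x : I -> Rd d) (r : I -> R) (U : Rd d -> Prop) (f : nat -> I) (tau t : R)
    (K : nat -> option (dcube d)) (c0 : dcube d) (n : nat) :
  (forall i, exists n, f n = i) ->
  homogeneous_ubiquitous N x r U -> 1 < tau -> 0 < t < INR d / tau ->
  (forall c, (forall m c', K m = Some c' -> ~ subcube c c') ->
     forall M, psum (wterm t K (fun c' => subcube c' c)) M <= weight t c) ->
  (forall m c, K m = Some c -> ~ subcube c0 c) -> (forall y, in_dcube c0 y -> U y) ->
  exists m c, (n <= m)%nat /\ (dc_j c0 < dc_j c)%Z /\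
    (forall w, in_dcube c w -> N (vsub w (x (f m))) < Rpower (r (f m)) tau) /\
    (forall w, (forall i, corner c i <= w i <= corner c i + side c) -> in_dcube c0 w) /\
    forall k c', K k = Some c' -> ~ subcube c c'.
Proof.
  intros Hsurj [Hsys Hnull] Htau Ht HK Hgood HU.
  destruct (norm_upper N HN) as [C1 [HC1 Hup]].
  destruct (norm_lower N HN) as [C0 [HC0 Hlow]].
  (* The new cube will satisfy [r^tau < 4 * C1 * side c], that is, [r < D * side c ^ (1/tau)]. *)
  pose (D := Rpower (4 * C1) (/ tau)); assert (HD : 0 < D) by apply exp_pos.
  destruct (point_off_inflated_cubes i0 tau t (C0 * D) c0 K
    (fun y => U y /\ ~ infinitely_many (fun i => N (vsub y (x i)) < r i)))
    as (z & mu & rho & Hmu & Hrho & Hz & HE & Hoff); auto; [nra|].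
  assert (Hz0 : in_dcube c0 z) by (apply in_dcubeE; intros i; specialize (Hz i); lra).
  assert (Hinf : infinitely_many (fun i => N (vsub z (x i)) < r i))
    by (apply NNPP; intros H; apply HE; auto).
  (* Ensures [C0 * r + r < Rmin rho mu]: the first term bounds the coordinates of [z - x_i], the
     second the side of the new cube. The cap at one gives [r^tau <= r]. *)
  pose (e := Rmin 1 (Rmin rho mu / (C0 + 1))).
  assert (Hrm : 0 < Rmin rho mu) by now apply Rmin_glb_lt.
  assert (He : 0 < e) by (apply Rmin_glb_lt; [lra | apply Rdiv_lt_0_compat; lra]).
  destruct (small_radius N HN x r f z n e Hsurj Hsys He Hinf) as (m & Hm & Hzm & Hrm').
  set (ri := r (f m)) in *; set (xi := x (f m)) in *.
  assert (Hri : 0 < ri) by apply (proj1 Hsys).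
  assert (Hr1 : ri < 1) by (eapply Rlt_le_trans; [exact Hrm' | apply Rmin_l]).
  assert (Hr2 : (C0 + 1) * ri < Rmin rho mu).
  { assert (H : ri < Rmin rho mu / (C0 + 1))
      by (eapply Rlt_le_trans; [exact Hrm' | apply Rmin_r]).
    apply (Rmult_lt_compat_l (C0 + 1)) in H; [|lra].
    replace ((C0 + 1) * (Rmin rho mu / (C0 + 1))) with (Rmin rho mu) in H by (field; lra).
    exact H. }
  pose proof (Rmin_l rho mu) as Hl; pose proof (Rmin_r rho mu) as Hr.
  pose (q := Rpower ri tau); assert (Hq : 0 < q) by apply exp_pos.
  assert (Hqr : q <= ri).
  { unfold q; rewrite <- (exp_ln ri) at 2 by auto; unfold Rpower.
    assert (ln ri < 0) by (rewrite <- ln_1; apply ln_increasing; lra).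
    apply Rlt_le, exp_increasing; nra. }
  (* The upper bound on the side puts the cube at [xi] inside the ball of radius [q]; the lower
     bound [q / (4 * C1)] is the one anticipated in [D]. *)
  destruct (dyadic_scale (q / (2 * C1))) as [j [Hj1 Hj2]]; [apply Rdiv_lt_0_compat; lra|].
  pose (c := cube_at j xi : dcube d).
  assert (Hsc : side c = powerRZ 2 (- j)) by reflexivity; rewrite <- Hsc in Hj1, Hj2.
  assert (Hs : 0 < side c) by apply side_pos.
  assert (Hs1 : C1 * side c <= q / 2).
  { apply (Rmult_le_compat_l C1) in Hj2; [|lra].
    replace (C1 * (q / (2 * C1))) with (q / 2) in Hj2 by (field; lra); exact Hj2. }
  assert (Hs2 : q < 4 * C1 * side c).
  { apply (Rmult_lt_compat_l (4 * C1)) in Hj1; [|lra].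
    replace (4 * C1 * (q / (2 * C1) / 2)) with q in Hj1 by (field; lra); exact Hj1. }
  assert (Hs3 : side c <= ri) by nra.
  assert (Hxi : in_dcube c xi) by apply in_cube_at.
  assert (Hxz : forall i, Rabs (z i - xi i) < C0 * ri).
  { intros i; eapply Rle_lt_trans; [apply (Hlow (vsub z xi) i)|].
    apply Rmult_lt_compat_l; auto. }
  assert (Hxi' := Hxi); rewrite in_dcubeE in Hxi'.
  assert (Hclos : forall w, (forall i, corner c i <= w i <= corner c i + side c) ->
                            in_dcube c0 w).
  { intros w Hw; apply in_dcubeE; intros i.
    specialize (Hw i); specialize (Hz i); specialize (Hxz i); specialize (Hxi' i).
    apply Rabs_def2 in Hxz; lra. }
  exists m, c; split; [exact Hm|]; split; [|split; [|split; [exact Hclos|]]].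
  - apply Z.opp_lt_mono, powerRZ2_lt_inv; fold (side c); fold (side c0).
    specialize (Hz i0); nra.
  - intros w Hw; fold ri xi q.
    apply Rle_lt_trans with (C1 * side c); [|lra].
    apply Hup; [lra|]; intros i; unfold vsub; apply Rabs_le.
    rewrite in_dcubeE in Hw; specialize (Hw i); specialize (Hxi' i); lra.
  - intros k c' HKk Hsub.
    assert (Hxc' : in_dcube c' xi) by (apply Hsub, Hxi).
    assert (Hxc0 : in_dcube c0 xi)
      by (apply Hclos; intros i; specialize (Hxi' i); lra).
    (* Both cubes contain [xi], hence are nested, and [Hgood] excludes [c0] inside [c']. *)
    assert (Hsub0 : subcube c' c0).
    { destruct (Z.le_ge_cases (dc_j c0) (dc_j c')).
      - eapply dyadic_nested; eauto.
      - destruct (Hgood k c' HKk); eapply dyadic_nested; eauto. }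
    (* As [c] lies in [c'], [q < 4 * C1 * side c'], so [C0 * ri] is within the inflation of [c'] and
       [z] is too close to its point [xi]. *)
    apply (Hoff k c' xi HKk Hsub0 Hxc'); intros i.
    apply Rlt_le_trans with (1 := Hxz i), Rmin_glb; [nra|].
    rewrite Rmult_assoc; apply Rmult_le_compat_l; [lra|].
    unfold D; pose proof (side_pos c').
    rewrite Rpower_mult_distr by lra.
    replace ri with (Rpower q (/ tau))
      by (unfold q; rewrite Rpower_mult, Rinv_r, Rpower_1; lra).
    apply Rle_Rpower_l; [apply Rlt_le, Rinv_0_lt_compat; lra|].
    apply (subcube_side i0) in Hsub; nra.
Qed.

(** The limit lies in every [g n]. A cube of [K] through it would meet every [g n] without
    containing any, hence be finer than all of them, while their levels grow without bound. *)
Lemma limit_point {d} (i0 : Fin.t d) (N : Rd d -> R) (HN : is_norm d N) {I : Type}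
    (x : I -> Rd d) (r : I -> R) (U : Rd d -> Prop) (f : nat -> I) (tau t : R)
    (K : nat -> option (dcube d)) (c0 : dcube d) :
  (forall n m, f n = f m -> n = m) -> (forall i, exists n, f n = i) ->
  homogeneous_ubiquitous N x r U -> 1 < tau -> 0 < t < INR d / tau ->
  (forall c, (forall m c', K m = Some c' -> ~ subcube c c') ->
     forall M, psum (wterm t K (fun c' => subcube c' c)) M <= weight t c) ->
  (forall m c, K m = Some c -> ~ subcube c0 c) -> (forall y, in_dcube c0 y -> U y) ->
  exists z, in_dcube c0 z /\
    infinitely_many (fun i => N (vsub z (x i)) < Rpower (r i) tau) /\
    forall m c, K m = Some c -> ~ in_dcube c z.
Proof.
  intros Hinj Hsurj Hub Htau Ht HK Hgood HU.
  destruct (dependent_choice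
    (fun n c c' => exists m, (n <= m)%nat /\ (dc_j c < dc_j c')%Z /\
      (forall w, in_dcube c' w -> N (vsub w (x (f m))) < Rpower (r (f m)) tau) /\
      (forall w, (forall i, corner c' i <= w i <= corner c' i + side c') -> in_dcube c w))
    (fun c => (forall k c', K k = Some c' -> ~ subcube c c') /\
              forall y, in_dcube c y -> U y) c0) as [g (Hg0 & Hinv & Hstep)].
  - split; auto.
  - intros n c [Hc HcU].
    destruct (refine_cube i0 N HN x r U f tau t K c n) as (m & c' & Hm & Hj & HNw & Hcl & Hc');
      auto.
    exists c'; split; [split; auto; intros y Hy|].
    + apply HcU, Hcl; intros i; rewrite in_dcubeE in Hy; specialize (Hy i); lra.
    + exists m; auto.
  - assert (Hcl : forall n w,
        (forall i, corner (g (S n)) i <= w i <= corner (g (S n)) i + side (g (S n))) ->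
        in_dcube (g n) w)
      by (intros n; destruct (Hstep n) as (m & _ & _ & _ & H); exact H).
    assert (Hlim : forall i, exists v, forall n,
        corner (g n) i <= v <= corner (g n) i + side (g n)).
    (* The corner and the opposite vertex of the closed cube [g (S n)] both lie in [g n], which
       orders the endpoints. *)
    { intros i; apply (nested_intervals (fun n => corner (g n) i)
                                        (fun n => corner (g n) i + side (g n)));
        intros n; pose proof (side_pos (g n)); pose proof (side_pos (g (S n))); try lra.
      - pose proof (Hcl n (corner (g (S n))) ltac:(intros; lra)) as H1.
        rewrite in_dcubeE in H1; apply H1.
      - pose proof (Hcl n (fun i => corner (g (S n)) i + side (g (S n))) ltac:(intros; lra))
          as H1.
        rewrite in_dcubeE in H1; specialize (H1 i); lra. }
    pose (z := fun i => proj1_sig (constructive_indefinite_description _ (Hlim i))).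
    (* Limits only give membership in closed cubes; the closed cube of index [S n] lies in the
       half-open one of index [n]. *)
    assert (Hz : forall n, in_dcube (g n) z).
    { intros n; apply Hcl; intros i.
      apply (proj2_sig (constructive_indefinite_description _ (Hlim i)) (S n)). }
    exists z; split; [rewrite <- Hg0; apply Hz | split].
    + apply (infinitely_many_enumerated f); auto; intros n.
      destruct (Hstep n) as (m & Hm & _ & HNw & _); exists m; auto.
    + intros m c Hm Hcz.
      assert (Hj : forall n, (dc_j (g n) < dc_j c)%Z).
      { intros n; destruct (Z_lt_le_dec (dc_j (g n)) (dc_j c)) as [|Hle]; auto.
        destruct (proj1 (Hinv n) m c Hm); eapply dyadic_nested; eauto. }
      assert (Hgrow : forall n, (dc_j (g O) + Z.of_nat n <= dc_j (g n))%Z).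
      { induction n as [|n IH]; [lia|]; destruct (Hstep n) as (? & _ & H & _); lia. }
      pose proof (Hgrow (Z.to_nat (dc_j c - dc_j (g O)))).
      pose proof (Hj (Z.to_nat (dc_j c - dc_j (g O)))); lia.
Qed.

(** * Cubes in open sets, the G-delta property, and the equality of contents *)

Lemma cube_in_open {d} (N : Rd d -> R) (HN : is_norm d N) (V : Rd d -> Prop) (y : Rd d) :
  is_open N V -> V y -> exists c, in_dcube c y /\ forall w, in_dcube c w -> V w.
Proof.
  intros HV Hy; destruct (HV y Hy) as [e [He Hball]].
  destruct (norm_upper N HN) as [C [HC Hup]].
  destruct (dyadic_scale (e / (2 * C))) as [j [_ Hj]]; [apply Rdiv_lt_0_compat; lra|].
  exists (cube_at j y); split; [apply in_cube_at|]; intros w Hw; apply Hball.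
  pose proof (in_cube_at j y) as Hy'; rewrite in_dcubeE in Hw, Hy'.
  pose proof (side_pos (cube_at j y)) as Hs.
  apply Rle_lt_trans with (C * side (cube_at j y)).
  - apply Hup; [lra|]; intros i; apply Rabs_le; unfold vsub.
    specialize (Hw i); specialize (Hy' i); lra.
  - rewrite side_cube_at in *; apply (Rmult_le_compat_l C) in Hj; [|lra].
    replace (C * (e / (2 * C))) with (e / 2) in Hj by (field; lra); lra.
Qed.

(** The limsup set is the intersection over [n] of the open unions of the balls of index at least
    [n]. *)
Lemma G_delta_limsup_balls {d} (N : Rd d -> R) (HN : is_norm d N) {I : Type}
    (x : I -> Rd d) (rad : I -> R) :
  countably_infinite I ->
  G_delta N (fun y => infinitely_many (fun i => N (vsub y (x i)) < rad i)).
Proof.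
  intros [f [Hinj Hsurj]].
  exists (fun n y => exists m, (n <= m)%nat /\ N (vsub y (x (f m))) < rad (f m)); split.
  - intros n y (m & Hm & Hy); exists (rad (f m) - N (vsub y (x (f m)))); split; [lra|].
    intros w Hw; exists m; split; auto.
    pose proof (norm_sub_triangle N HN w y (x (f m))); lra.
  - intros y; exact (infinitely_many_enumerated f
      (fun i => N (vsub y (x i)) < rad i) Hinj Hsurj).
Qed.

Theorem theorem5p9 (d : nat) (Hd : (1 <= d)%nat) (N : Rd d -> R) (HN : is_norm d N)
  (I : Type) (HI : countably_infinite I) (x : I -> Rd d) (r : I -> R)
  (U : Rd d -> Prop) (HUo : is_open N U) (HUne : exists y, U y)
  (Hub : homogeneous_ubiquitous N x r U)
  (tau : R) (Htau : 1 < tau) :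
  in_G N (INR d / tau) U
    (fun y => infinitely_many (fun i => N (vsub y (x i)) < Rpower (r i) tau)).
Proof.
  split; [exact (G_delta_limsup_balls N HN x _ HI)|].
  intros t Ht V HV HVU; split.
  (* The easy inequality: a cover of [V] covers every subset of [V]. *)
  2: { intros b (cov & Hcov & Hsum) e He; exists b; split; [|lra].
       exists cov; split; auto; intros y [_ Hy]; auto. }
  intros a (lam & Hlam & Ha) e He.
  assert (i0 : Fin.t d) by (destruct d; [lia | exact Fin.F1]).
  destruct HI as [f [Hinj Hsurj]].
  destruct (diam_dcube i0 N HN) as [delta [Hdelta Hdiam]].
  (* Diameters to the power [t] are [D] times weights, so the given cover has total weight
     [a / D]. *)
  pose (D := Rpower delta t); assert (HD : 0 < D) by apply exp_pos.
  assert (Hterm : forall cov, (fun n => match cov n with None => 0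
      | Some c => Rpower (diam N (in_dcube c)) t end)
      = fun n => D * wterm t cov (fun _ : dcube d => True) n).
  { intros cov; apply functional_extensionality; intros n; unfold wterm.
    destruct (cov n) as [c|]; [|ring].
    destruct excluded_middle_informative; [|tauto].
    rewrite Hdiam, <- Rpower_mult_distr by auto using side_pos; reflexivity. }
  assert (Hpos : forall cov n, 0 <= D * wterm t cov (fun _ : dcube d => True) n)
    by (intros; apply Rmult_le_pos; [lra | apply wterm_nonneg]).
  rewrite Hterm in Ha.
  destruct (saturate i0 t (a / D) lam) as (K & HlamK & HKsum & HKgood); [lra| |].
  { intros n; apply (Rmult_le_reg_l D); auto.
    replace (D * (a / D)) with a by (field; lra).
    rewrite <- psum_scal; revert n; apply psum_le_infinite_sum; auto. }
  destruct (infinite_sum_of_bounded (fun n => D * wterm t K (fun _ => True) n) a)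
    as [b [Hb Hba]]; auto.
  { intros n; rewrite psum_scal; specialize (HKsum n).
    apply (Rmult_le_compat_l D) in HKsum; [|lra].
    replace (D * (a / D)) with a in HKsum by (field; lra); auto. }
  exists b; split; [|lra].
  exists K; split; [|rewrite Hterm; exact Hb].
  (* If [K] missed [y], a cube around [y] in [V] would lie in no member of [K], and [limit_point]
     would give a point of the limsup set in [V] outside [K]; but [lam] covers that point and each
     of its cubes lies in one of [K]. *)
  intros y Hy; apply NNPP; intros Hno.
  destruct (cube_in_open N HN V y HV Hy) as [c0 [Hc0 Hc0V]].
  destruct (limit_point i0 N HN x r U f tau t K c0) as (z & Hz & Hinf & HzK); auto.
  { intros m c Hm Hsub; apply Hno; exists m, c; auto. }
  destruct (Hlam z) as (k & c & Hk & Hcz); [auto|].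
  destruct (HlamK k c Hk) as (m & c' & Hm & Hsub); exact (HzK m c' Hm (Hsub z Hcz)).
Qed.
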